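(* Consider the single-component replacement model described in the context, with parameters $\mu_1,\mu_2,\lambda,\tau>0$ and costs $0<c_p^{\mathrm{so}}\le c_p^{\mathrm{uso}}<c_c$. Let $\tilde t\in(0,\tau)$ and consider the policy under which: in state $2$ we do nothing at every opportunity; in state $1$ we replace at every scheduled opportunity and at every unscheduled opportunity for which the remaining time until the next scheduled opportunity is greater than $\tilde t$, and we do nothing otherwise. Then the long-run average cost of this policy is $$ \begin{aligned} \frac1\tau\Bigg[\,& c_c\mu_1\left(\tilde t\,\frac{\mu_2}{\mu_1+\mu_2}+\left(\frac{\mu_2}{\lambda+\mu_1+\mu_2}-\frac{\mu_2}{\mu_1+\mu_2}-\frac{\mu_2}{\lambda+\mu_1+\mu_2}e^{(\lambda+\mu_1+\mu_2)(\tilde t-\tau)}\right)\frac{1}{\mu_1+\mu_2}\left(1-e^{-(\mu_1+\mu_2)\tilde t}\right)\right)\\ &+\left(c_p^{\mathrm{uso}}\lambda+c_c\mu_1\right)\frac{\mu_2}{\lambda+\mu_1+\mu_2}\left(\tau-\tilde t-\frac{1}{\lambda+\mu_1+\mu_2}\left(1-e^{(\lambda+\mu_1+\mu_2)(\tilde t-\tau)}\right)\right)\\ &+c_p^{\mathrm{so}}\left(\frac{\mu_2}{\mu_1+\mu_2}+\left(\frac{\mu_2}{\lambda+\mu_1+\mu_2}-\frac{\mu_2}{\mu_1+\mu_2}-\frac{\mu_2}{\lambda+\mu_1+\mu_2}e^{(\lambda+\mu_1+\mu_2)(\tilde t-\tau)}\right)e^{-(\mu_1+\mu_2)\tilde t}\right)\Bigg].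 \end{aligned} $$
   Context: Model. A single component has a fully observable, continuously monitored condition: state $2$ (perfect), state $1$ (satisfactory) or state $0$ (failed). It starts at time $0$ in state $2$. If not replaced, it spends an exponential time with rate $\mu_2$ in state $2$, then moves to state $1$, where it spends an exponential time with rate $\mu_1$, after which it fails. At failure it is instantaneously replaced by an as-good-as-new component (state $2$), at corrective cost $c_c$; hence the condition effectively evolves between states $1$ and $2$. Opportunities. Scheduled opportunities (SO) occur at the deterministic times $\tau,2\tau,3\tau,\dots$. Unscheduled opportunities (USO) occur according to a Poisson process of rate $\lambda$. All sojourn times and the Poisson process are independent. At each SO or USO epoch one chooses an action from $\{\text{replace},\text{do nothing}\}$. Replacing instantaneously puts the component in state $2$ (as good as new) at preventive cost $c_p^{\mathrm{so}}$ at an SO and $c_p^{\mathrm{uso}}$ at a USO. Doing nothing costs nothing and leaves the condition unchanged. The long-run average cost (per time unit) of a policy is $\lim_{T\to\infty}\frac1T\,\mathbb{E}[\text{total cost incurred in }[0,T]]$, where the total cost includes corrective and preventive replacement costs. *)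

(* Defs.v *)
From HB Require Import structures.
From mathcomp Require Import all_boot all_order all_algebra.
From mathcomp Require Import all_classical all_reals all_analysis.

Set Implicit Arguments.
Unset Strict Implicit.
Unset Printing Implicit Defensive.

Import Order.TTheory GRing.Theory Num.Theory.
Import numFieldNormedType.Exports.

Local Open Scope classical_set_scope.
Local Open Scope ring_scope.

Inductive condition := failed | satisfactory | perfect.

Inductive opportunity := SO | USO.

Inductive action := replace | do_nothing.

(* The third argument is the remaining time until the next SO, strictly after
   the current epoch. *)
Definition policy (R : realType) := condition -> opportunity -> R -> action.

Definition threshold_policy (R : realType) (ttilde : R) : policy R :=
  fun c o r =>
    match c, o with
    | satisfactory, SO => replace
    | satisfactory, USO => if ttilde < r then replace else do_nothing
    | _, _ => do_nothing
    end.

Inductive cause := corrective | preventive of opportunity.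

Definition cause_cost (R : realType) (cc cso cuso : R) (e : cause) : R :=
  match e with
  | corrective => cc
  | preventive SO => cso
  | preventive USO => cuso
  end.

(* One sample path.  The k-th component (k = 0, 1, ...) would spend x2 k in
   state 2 and then x1 k in state 1 if it were not replaced before failing;
   w n is the n-th interarrival time of the unscheduled opportunities. *)
Section SamplePath.
Context {R : realType}.
Variables (tau : R) (pi : policy R) (x2 x1 w : nat -> R).

Definition remaining_time (t : R) : R := (Num.floor (t / tau) + 1)%:~R * tau - t.

Definition epochs (o : opportunity) : set R :=
  match o with
  | SO => [set t | exists n : nat, t = n.+1%:R * tau]
  | USO => [set t | exists n : nat, t = \sum_(i < n.+1) w i]
  end.

Definition condition_at_age (k : nat) (a : R) : condition :=
  if a < x2 k then perfect
  else if a < x2 k + x1 k then satisfactory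
  else failed.

(* Epochs of type o at which component k, installed at time s and still
   working, is replaced according to the policy. *)
Definition replacing_epochs (k : nat) (s : R) (o : opportunity) : set R :=
  [set t | [/\ s < t < s + (x2 k + x1 k), epochs o t &
    pi (condition_at_age k (t - s)) o (remaining_time t) = replace]].

(* Time at which component k, installed at time s, is replaced: the first
   replacing epoch, or the failure time if there is none. *)
Definition removal_time (k : nat) (s : R) : R :=
  inf ([set s + (x2 k + x1 k)] `|`
       (replacing_epochs k s SO `|` replacing_epochs k s USO)).

Fixpoint installation_time (k : nat) : R :=
  if k is k'.+1 then removal_time k' (installation_time k') else 0.

(* An SO and a USO coincide with probability 0, so the precedence given to
   SO is immaterial. *)
Definition removal_cause (k : nat) : cause :=
  let s := installation_time k in
  if removal_time k s \in replacing_epochs k s SO then preventive SO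
  else if removal_time k s \in replacing_epochs k s USO then preventive USO
  else corrective.

Definition total_cost (cc cso cuso T : R) : \bar R :=
  (\sum_(0 <= k <oo)
     (if installation_time k.+1 <= T
      then cause_cost cc cso cuso (removal_cause k) else 0)%:E)%E.

End SamplePath.

Section Probability.
Context {d : measure_display} {Omega : measurableType d} {R : realType}.
Variable P : probability Omega R.

Definition exponentially_distributed (rate : R) (X : {RV P >-> R}) : Prop :=
  forall A : set R, measurable A ->
    distribution P X A = exponential_prob rate A.

Definition mutually_independent (I : eqType) (X : I -> {RV P >-> R}) : Prop :=
  forall (J : seq I) (A : I -> set R),
    uniq J -> (forall i, measurable (A i)) ->
    P (\big[setI/setT]_(i <- J) (X i @^-1` A i)) =
    (\prod_(i <- J) P (X i @^-1` A i))%E.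

(* The three sequences as a single family, so that independence is required
   both within and across them. *)
Definition joint_family (X2 X1 W : nat -> {RV P >-> R})
    (i : nat + nat + nat) : {RV P >-> R} :=
  match i with
  | inl (inl k) => X2 k
  | inl (inr k) => X1 k
  | inr n => W n
  end.

(* The unscheduled opportunities form a Poisson process of rate lambda:
   its interarrival times W are i.i.d. exponential of rate lambda. *)
Definition replacement_model (mu1 mu2 lambda : R)
    (X2 X1 W : nat -> {RV P >-> R}) : Prop :=
  [/\ forall k, exponentially_distributed mu2 (X2 k),
      forall k, exponentially_distributed mu1 (X1 k),
      forall n, exponentially_distributed lambda (W n) &
      mutually_independent (joint_family X2 X1 W)].

Definition expected_total_cost (tau cc cso cuso : R) (pi : policy R)
    (X2 X1 W : nat -> {RV P >-> R}) (T : R) : \bar R :=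
  (\int[P]_omega
     total_cost tau pi (X2 ^~ omega) (X1 ^~ omega) (W ^~ omega) cc cso cuso T)%E.

(* Existence of the limit is part of the claim. *)
Definition has_long_run_average_cost (tau cc cso cuso : R) (pi : policy R)
    (X2 X1 W : nat -> {RV P >-> R}) (c : R) : Prop :=
  ((T^-1)%:E * expected_total_cost tau cc cso cuso pi X2 X1 W T)%E
    @[T --> +oo] --> c%:E.

End Probability.

(* Main.v *)
Require Import Defs.
From HB Require Import structures.
From mathcomp Require Import all_boot all_order all_algebra.
From mathcomp Require Import all_classical all_reals all_analysis.
From mathcomp Require Import measurable_realfun.
From mathcomp Require Import ring lra.
Set Implicit Arguments.
Unset Strict Implicit.
Unset Printing Implicit Defensive.
Import Order.TTheory GRing.Theory Num.Theory.
Import numFieldNormedType.Exports.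
Local Open Scope classical_set_scope.
Local Open Scope ring_scope.

(** Why the formula holds.

    Every quantity is driven by countably many independent exponential clocks:
    the two sojourn times of each component and the gaps between unscheduled
    opportunities.  The proof uses neither the strong Markov property nor
    renewal theory.  It computes expected numbers of events from one identity,
    [compensator], valid for a single clock: if that clock has rate r and is
    independent of all the others, the probability of an event B equals r times
    the expected length of the set of instants u at which the clock is still
    running and B would occur if the clock were made to ring at u.  It follows
    from resampling the clock ([resampling]) and from the tail exp (- r x) of the
    exponential law.

    Applied to the three kinds of clocks, with the pathwise description of what
    happens when one clock is made to ring earlier ([fails_upd1],
    [installed_causal], [opportunity_upd]), it says that degradations occur at
    rate mu2 while the component is perfect, failures at rate mu1 while it is
    satisfactory, and replacements at unscheduled opportunities at rate lambda
    while it is satisfactory and more than ttilde remains until the next scheduled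
    opportunity.  Let p u be the probability of being satisfactory at time u.
    Entries into and exits from that state balance ([conservation]):
    mu2 int_0^t (1 - p) = p t + mu1 int_0^t p + lambda int_0^t 1_window p + N t,
    where N t is the expected number of replacements at scheduled opportunities
    up to t.  The same integral identities show that only finitely many events
    are expected in bounded time, so that explosion is excluded and p is one minus
    the probability of the perfect state ([state_total]).

    The function N is constant between scheduled opportunities and p vanishes at
    each of them, so on every cycle the balance is a linear integral equation
    with constant coefficients on the part where unscheduled opportunities are
    used, and another one on the part where they are not.  Solving them
    ([linear_integral_equation], [cycle_integrals]) gives the expected cost of a
    cycle, which is the same for all cycles.  The expected cost is nondecreasing
    in the horizon, hence its time average converges to the cost of a cycle
    divided by tau ([monotone_average]). *)


(** * Paths of independent clocks *)

Definition clock := (nat + nat + nat)%type.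

(** Sides outside J are the whole line, so that finite dimensional cylinders can be
    intersected side by side and the system is visibly closed under intersection. *)
Definition cylinders (R : realType) : set (set (clock -> R)) :=
  [set B | exists (J : seq clock) (A : clock -> set R),
     [/\ forall i, measurable (A i), forall i, i \notin J -> A i = setT &
         B = [set xi | forall i, A i (xi i)]]].

Notation path_space R := (g_sigma_algebraType (@cylinders R)).

Definition coordinate (R : realType) (i : clock) (xi : path_space R) : R := xi i.

Lemma setI_closed_cylinders (R : realType) : setI_closed (@cylinders R).
Proof.
move=> _ _ [J [A [mA AT ->]]] [K [B [mB BT ->]]].
exists (J ++ K), (fun i => A i `&` B i); split.
- by move=> i; exact: measurableI.
- by move=> i; rewrite mem_cat negb_or => /andP[/AT -> /BT ->]; rewrite setIT.
- by apply/seteqP; split => [xi [hA hB] i|xi h]; split => // i; have [] := h i.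
Qed.

Lemma measurable_coordinate (R : realType) (i : clock) :
  measurable_fun setT (@coordinate R i).
Proof.
move=> _ A mA; rewrite setTI; apply: sub_sigma_algebra.
exists [:: i], (fun j => if j == i then A else setT); split.
- by move=> j; case: ifP.
- by move=> j; rewrite inE => /negbTE ->.
- apply/seteqP; split => [xi xiA j|xi /(_ i)]; last by rewrite eqxx.
  by case: eqP => // ->.
Qed.

Lemma measurable_to_path_space (R : realType) d (T : measurableType d)
    (f : T -> path_space R) :
  (forall i, measurable_fun setT (fun t => f t i)) -> measurable_fun setT f.
Proof.
move=> mf; apply: (@measurability _ _ _ (path_space R) setT f (@cylinders R)) => //.
move=> _ [_ [J [A [mA AT ->]]] <-]; rewrite setTI.
rewrite (_ : _ @^-1` _ = \big[setI/setT]_(i <- J) ((fun t => f t i) @^-1` A i)).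
  by apply: bigsetI_measurable => i _; rewrite -[_ @^-1` _]setTI; exact: mf.
rewrite -bigcap_seq; apply/seteqP; split => [t ft i _|t ft i]; first exact: ft.
by have [/ft//|/AT ->] := boolP (i \in J).
Qed.

Definition with_coordinate (R : realType) (xi : path_space R) (i : clock) (x : R)
  : path_space R := fun j => if j == i then x else xi j.

Lemma measurable_with_coordinate (R : realType) d (T : measurableType d)
    (f : T -> path_space R) (i : clock) (g : T -> R) :
  measurable_fun setT f -> measurable_fun setT g ->
  measurable_fun setT (fun t => with_coordinate (f t) i (g t)).
Proof.
move=> mf mg; apply: measurable_to_path_space => j; rewrite /with_coordinate.
case: (j == i) => //.
exact: (measurableT_comp (measurable_coordinate (R := R) j) mf).
Qed.

HB.instance Definition _ (R : realType) (i : clock) :=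
  isMeasurableFun.Build _ _ _ _ (@coordinate R i) (@measurable_coordinate R i).

(** Mutual independence stated on the cylinders, a pi-system that generates the
    sigma-algebra and therefore determines the law. *)
Definition independent_exponentials (R : realType)
    (L : probability (path_space R) R) (rate : clock -> R) :=
  forall (J : seq clock) (A : clock -> set R), uniq J ->
    (forall i, measurable (A i)) ->
    L [set xi | forall i, i \in J -> A i (xi i)] =
    (\prod_(i <- J) exponential_prob (rate i) (A i))%E.

Section Resampling.
Context (R : realType) (L : probability (path_space R) R) (rate : clock -> R).
Hypothesis indep : independent_exponentials L rate.

Lemma law_coordinate i A : measurable A ->
  distribution L (@coordinate R i) A = exponential_prob (rate i) A.
Proof.
move=> mA; rewrite /distribution /pushforward.
have := indep (J := [:: i]) (A := fun=> A) erefl (fun=> mA).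
rewrite big_seq1 => <-; congr (L _); apply/seteqP; split => [xi /= h j|xi /= h].
  by rewrite inE => /eqP ->.
by apply: h; rewrite inE.
Qed.

(** Replacing one clock by an independent copy does not change the law of the path:
    both laws give the product formula on cylinders, and cylinders determine a
    probability. *)
Lemma resampling i (B : set (path_space R)) : measurable B ->
  L B = (L \x distribution L (@coordinate R i))%E
          [set p | B (with_coordinate p.1 i p.2)].
Proof.
move=> mB.
pose Phi (p : path_space R * R) := with_coordinate p.1 i p.2.
have mPhi : measurable_fun setT Phi.
  by apply: measurable_with_coordinate; [exact: measurable_fst|exact: measurable_snd].
pose PhiM : {mfun _ >-> _} := HB.pack Phi (isMeasurableFun.Build _ _ _ _ Phi mPhi).
have mcyl : @cylinders R `<=` (@cylinders R).-sigma.-measurable.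
  by move=> A cA; exact: sub_sigma_algebra.
have cylT : @cylinders R [set: clock -> R].
  by exists [::], (fun=> setT); split => //; apply/seteqP; split.
apply: (@g_sigma_algebra_measure_unique _ R (path_space R) (@cylinders R) mcyl
  (fun=> setT) _ _ L (pushforward (L \x distribution L (@coordinate R i))%E PhiM)) => //.
- by apply/seteqP; split => // x _; exists 0%N.
- exact: setI_closed_cylinders.
- move=> _ [J [A [mA AT ->]]]; rewrite /pushforward /=.
  (* The cylinder is rewritten with i among its sides and without repetitions,
     so that both laws factor over the same list. *)
  pose K := rem i (undup J).
  have uK : uniq (i :: K).
    by rewrite /= rem_uniq ?undup_uniq// mem_rem_uniq ?undup_uniq// inE eqxx.
  have subK j : j != i -> j \in J -> j \in K.
    by move=> ji jJ; rewrite mem_rem_uniq ?undup_uniq// inE ji mem_undup.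
  have NK j : j \in K -> j != i.
    by rewrite mem_rem_uniq ?undup_uniq// inE => /andP[].
  transitivity (L [set xi | forall j, j \in i :: K -> A j (xi j)]).
    congr (L _); apply/seteqP; split => [xi h j _|xi h j]; first exact: h.
    have [jJ|/AT ->//] := boolP (j \in J).
    by apply: h; rewrite inE; have [//|ji] := eqVneq j i; rewrite subK.
  transitivity ((L \x distribution L (@coordinate R i))%E
    ([set xi | forall j, j \in K -> A j (xi j)] `*` A i)); last first.
    congr (_ _); apply/seteqP; split => -[xi x] /=.
      move=> [h Ax] j; rewrite /Phi /with_coordinate/=; case: eqVneq => [->//|ji].
      by have [/(subK _ ji)/h|/AT ->] := boolP (j \in J).
    rewrite /Phi /with_coordinate/= => h; split; last first.
      by have := h i; rewrite eqxx.
    by move=> j jK; have := h j; rewrite (negbTE (NK _ jK)).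
  have mK : measurable [set xi : path_space R | forall j, j \in K -> A j (xi j)].
    rewrite (_ : mkset _ = \big[setI/setT]_(j <- K) (@coordinate R j @^-1` A j)).
      apply: bigsetI_measurable => j _; rewrite -[_ @^-1` _]setTI.
      exact: measurable_coordinate.
    by rewrite -bigcap_seq.
  rewrite product_measure1E//= law_coordinate// !indep//; last by case/andP: uK.
  by rewrite big_cons muleC.
- by move=> _; apply: (le_lt_trans (probability_le1 L _)); rewrite ?ltry//; exact: measurableT.
Qed.

End Resampling.

(** * Resampling one clock and the compensator formula *)

Lemma measurable_set_preimage d d' (T : measurableType d) (T' : measurableType d')
    (f : T -> T') (B : set T') :
  measurable_fun setT f -> measurable B -> measurable [set x | B (f x)].
Proof. by move=> mf mB; rewrite -[mkset _]setTI; exact: mf. Qed.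

Section MeasurableComparisons.
Context d (T : measurableType d) (R : realType) (f g : T -> R).
Hypotheses (mf : measurable_fun setT f) (mg : measurable_fun setT g).

Lemma measurable_set_lt : measurable [set x | f x < g x].
Proof.
have := @measurable_fun_ltr _ _ _ setT _ _ mf mg measurableT [set true] I.
by rewrite setTI.
Qed.

Lemma measurable_set_le : measurable [set x | f x <= g x].
Proof.
have := @measurable_fun_ler _ _ _ setT _ _ mf mg measurableT [set true] I.
by rewrite setTI.
Qed.

Lemma measurable_set_eq : measurable [set x | f x = g x].
Proof.
have := @measurable_fun_eqr _ _ _ setT _ _ mf mg measurableT [set true] I.
rewrite setTI; congr measurable; apply/seteqP; split => x /= /eqP //.
Qed.

End MeasurableComparisons.

(** Lets the age x of a clock be traded for the calendar time at which it rings. *)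
Lemma lebesgue_measure_shift (R : realType) (c : R) (A : set R) : measurable A ->
  lebesgue_measure ((fun u => u - c) @^-1` A) = lebesgue_measure A.
Proof.
move=> mA.
have mshift : measurable_fun setT (fun u : measurableTypeR R => u - c : measurableTypeR R).
  by apply: measurable_funB => //; exact: measurable_cst.
pose shift : {mfun measurableTypeR R >-> measurableTypeR R} :=
  HB.pack (fun u => u - c) (isMeasurableFun.Build _ _ _ _ _ mshift).
apply/esym.
apply: (@lebesgue_measure_unique R (pushforward (@lebesgue_measure R) shift)) => //.
move=> _ [[a b]] _ <-; rewrite /pushforward /=.
rewrite [X in _ = lebesgue_measure X](_ : _ = `]a + c, b + c]%classic); last first.
  by apply/seteqP; split => u /=; rewrite !in_itv/= ltrBrDr lerBlDr.
rewrite !lebesgue_measure_itv/= !lte_fin ltrD2r.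
by case: ifP => // _; rewrite -!EFinD; congr (_%:E); ring.
Qed.

Lemma lebesgue_measure_eq_off_countable (R : realType) (A B Z : set R) :
  measurable A -> measurable B -> countable Z ->
  (forall u, ~ Z u -> A u <-> B u) -> lebesgue_measure A = lebesgue_measure B.
Proof.
move=> mA mB cZ AB.
have mZ : measurable Z by exact: countable_measurable.
have Z0 : lebesgue_measure Z = 0%E by exact: countable_lebesgue_measure0.
have le (C D : set R) : measurable C -> measurable D ->
    (forall u, ~ Z u -> C u -> D u) -> (lebesgue_measure C <= lebesgue_measure D)%E.
  move=> mC mD CD; rewrite -(@measureU0 _ _ _ (@lebesgue_measure R) _ _ mD mZ Z0).
  apply: le_measure; rewrite ?inE//; first exact: measurableU.
  by move=> u Cu; have [Zu|nZu] := pselect (Z u); [right|left; exact: CD].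
by apply/eqP; rewrite eq_le !le// => u nZ; rewrite AB.
Qed.

Lemma exponential_prob_itvcy (R : realType) (r x : R) : 0 < r -> 0 <= x ->
  exponential_prob r `[x, +oo[ = (expR (- r * x))%:E.
Proof.
move=> r0 x0.
have cE : continuous (fun z : R^o => expR (- r * z)).
  move=> z; apply: continuous_comp; last exact: continuous_expR.
  by apply: continuousM => //; apply: (@continuousN _ R^o); exact: cst_continuous.
rewrite /exponential_prob (@ge0_continuous_FTC2y _ _
  (fun x => - (expR (- r * x))) _ 0)//.
- by rewrite EFinN oppeK add0e.
- by move=> y _; apply: exponential_pdf_ge0; exact: ltW.
- apply: (@continuous_subspaceW R^o _ _ [set` `[0, +oo[%R]).
    by move=> y /=; rewrite !in_itv/= !andbT; exact: le_trans.
  exact: within_continuous_exponential_pdf.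
- rewrite -oppr0; apply: cvgN.
  rewrite (_ : (fun x => expR (- r * x)) =
               (fun z => expR (- z)) \o (fun z => r * z)); last first.
    by apply: eq_fun => y; rewrite mulNr.
  apply: (@cvg_comp _ _ _ _ _ _ (pinfty_nbhs R)); last exact: cvgr_expR.
  exact: gt0_cvgMry.
- by apply: cvgN; apply/cvg_at_right_filter; exact: cE.
- move=> y; rewrite in_itv/= andbT => xy.
  by apply: derive1_exponential_pdf; rewrite in_itv/= andbT; exact: le_lt_trans xy.
Qed.

Lemma tonelli_sections d1 d2 (T1 : measurableType d1) (T2 : measurableType d2)
    (R : realType) (m1 : {sigma_finite_measure set T1 -> \bar R})
    (m2 : {sigma_finite_measure set T2 -> \bar R}) (N : set (T1 * T2)) :
  measurable N ->
  (\int[m1]_x m2 [set y | N (x, y)] = \int[m2]_y m1 [set x | N (x, y)])%E.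
Proof.
move=> mN; have := @indic_fubini_tonelli _ _ _ _ _ m1 m2 _ mN.
rewrite indic_fubini_tonelli_FE// indic_fubini_tonelli_GE//= => h.
transitivity (\int[m1]_x (m2 \o xsection N) x)%E.
  by apply: eq_integral => x _ /=; congr (m2 _); apply/seteqP; split => y /=;
    rewrite xsectionE.
rewrite h; apply: eq_integral => x _ /=; congr (m1 _).
by apply/seteqP; split => y /=; rewrite ysectionE.
Qed.

Section Compensator.
Context (R : realType) (L : probability (path_space R) R) (rate : clock -> R).
Hypothesis rate_gt0 : forall i, 0 < rate i.
Hypothesis indep : independent_exponentials L rate.
Local Notation leb := (@lebesgue_measure R).

(** The law of the resampled clock has the exponential density, so the resampling
    identity becomes an integral over its value x. *)
Lemma clock_disintegration i (B : set (path_space R)) : measurable B ->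
  (L B = \int[leb]_x ((exponential_pdf (rate i) x)%:E *
            L [set xi | B (with_coordinate xi i x)]))%E.
Proof.
move=> mB; rewrite (resampling indep i mB).
set M := [set p : path_space R * R | _].
have mM : measurable M.
  apply: measurable_set_preimage mB; apply: measurable_with_coordinate.
    exact: measurable_fst.
  exact: measurable_snd.
pose f (p : path_space R * R) : \bar R :=
  ((exponential_pdf (rate i) p.2)%:E * (\1_M p)%:E)%E.
have mf : measurable_fun setT f.
  apply: emeasurable_funM.
    apply/measurable_EFinP; apply: measurableT_comp => //.
    exact: measurable_exponential_pdf.
  by apply/measurable_EFinP.
have f0 p : (0 <= f p)%E.
  by rewrite mule_ge0// lee_fin// exponential_pdf_ge0// ltW.
transitivity (\int[L]_xi \int[leb]_x f (xi, x))%E.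
  rewrite /product_measure1 /=; apply: eq_integral => xi _.
  have mx : measurable (xsection M xi) by exact: measurable_xsection.
  rewrite -/(distribution L _ _) (law_coordinate indep)// /exponential_prob.
  rewrite integral_mkcond; apply: eq_integral => x _; rewrite /f/=.
  rewrite patchE indicE; have -> : (x \in xsection M xi) = ((xi, x) \in M).
    by rewrite mem_xsection.
  by case: ifP => _; rewrite ?mule1 ?mule0.
rewrite (@fubini_tonelli _ _ _ _ R L leb f)//; apply: eq_integral => x _.
have mBx : measurable [set xi : path_space R | B (with_coordinate xi i x)].
  apply: measurable_set_preimage mB.
  by apply: measurable_with_coordinate; [exact: measurable_id|exact: measurable_cst].
have -> : (fun xi : path_space R => f (xi, x)) = (fun xi =>
    (exponential_pdf (rate i) x)%:E *
    (\1_[set xi : path_space R | B (with_coordinate xi i x)] xi)%:E)%E by [].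
rewrite ge0_integralZl//; first last.
- by rewrite lee_fin exponential_pdf_ge0// ltW.
- exact/measurable_EFinP.
by rewrite integral_indic// setIT.
Qed.

(** Given that clock i exceeds x, a probability exp (- r x), the other clocks are
    unaffected; multiplied by r this is the density of the clock at x, whence
    L B = r int_0^oo L (clock i >= x, and B holds with x as value of clock i) dx.
    The variable u = Y + x is the calendar time at which a clock started at time Y
    would ring.  Since Y is applied to each path separately, it may depend on all the
    clocks.  The countable set Z absorbs coincidences at
    the boundary of the relevant time intervals. *)
Lemma compensator i (Y : path_space R -> R) (B : set (path_space R))
    (M : set (path_space R * R)) : measurable B -> measurable M ->
  (forall xi, exists2 Z : set R, countable Z & forall u, ~ Z u ->
     (M (xi, u) <->
      Y xi < u <= Y xi + xi i /\ B (with_coordinate xi i (u - Y xi)))) ->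
  (L B = (rate i)%:E * \int[leb]_u L [set xi | M (xi, u)])%E.
Proof.
move=> mB mM MB.
pose N : set (path_space R * R) :=
  [set p | 0 <= p.2 /\ p.2 <= p.1 i /\ B (with_coordinate p.1 i p.2)].
have mN : measurable N.
  apply: measurableI.
    by apply: measurable_set_le; [exact: measurable_cst|exact: measurable_snd].
  apply: measurableI.
    apply: measurable_set_le; first exact: measurable_snd.
    exact: (measurableT_comp (@measurable_coordinate R i) measurable_fst).
  apply: measurable_set_preimage mB; apply: measurable_with_coordinate.
    exact: measurable_fst.
  exact: measurable_snd.
have mupd x : measurable [set xi : path_space R | B (with_coordinate xi i x)].
  apply: measurable_set_preimage mB.
  by apply: measurable_with_coordinate; [exact: measurable_id|exact: measurable_cst].
transitivity ((rate i)%:E * \int[leb]_x L [set xi | N (xi, x)])%E.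
  rewrite (clock_disintegration i mB) -ge0_integralZl//; first last.
  - by rewrite lee_fin ltW.
  - have := measurable_fun_ysection L mN; congr measurable_fun.
    by apply/funext => x /=; congr (L _); apply/seteqP; split => xi /=; rewrite ysectionE.
  apply: eq_integral => x _; have [x0|x0] := ltP x 0.
    rewrite lt0_exponential_pdf// mul0e (_ : mkset _ = set0) ?measure0 ?mule0//.
    by apply/seteqP; split => // xi [/=]; rewrite leNgt x0.
  rewrite exponential_pdfE// EFinM -muleA; congr (_ * _)%E.
  have mNx : measurable [set xi | N (xi, x)].
    rewrite (_ : mkset _ = ysection N x); first exact: measurable_ysection.
    by apply/seteqP; split => xi /=; rewrite ysectionE.
  rewrite [RHS](resampling indep i mNx).
  rewrite (_ : mkset _ = [set xi : path_space R | B (with_coordinate xi i x)] `*`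
    `[x, +oo[%classic); last first.
    apply/seteqP; split => -[xi y]; rewrite /N/= /with_coordinate eqxx in_itv/= andbT.
      move=> [_ [xy By]]; split => //; congr B: By; apply/funext => j.
      by case: eqP.
    move=> [By xy]; split => //; split => //; congr B: By; apply/funext => j.
    by case: eqP.
  rewrite product_measure1E//= muleC; congr (_ * _)%E.
  by rewrite [RHS](law_coordinate indep)// exponential_prob_itvcy.
congr (_ * _)%E; rewrite -(tonelli_sections L leb mN) -(tonelli_sections L leb mM).
apply: eq_integral => xi _.
have mNxi : measurable [set x | N (xi, x)].
  rewrite (_ : mkset _ = xsection N xi); first exact: measurable_xsection.
  by apply/seteqP; split => x /=; rewrite xsectionE.
have mMxi : measurable [set x | M (xi, x)].
  rewrite (_ : mkset _ = xsection M xi); first exact: measurable_xsection.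
  by apply/seteqP; split => x /=; rewrite xsectionE.
transitivity (leb ((fun u => u - Y xi) @^-1` [set x | N (xi, x)])).
  exact/esym/lebesgue_measure_shift.
have [Z cZ ZE] := MB xi.
apply: (@lebesgue_measure_eq_off_countable _ _ _ (Z `|` [set Y xi])) => //.
- by apply: measurable_set_preimage mNxi; apply: measurable_funB => //; exact: measurable_cst.
- rewrite -bigcup2E; apply: bigcup_countable => // -[|[|n]] _ /=; 
  [exact: cZ|exact: countable1|exact: countable0].
move=> u /not_orP[nZ /eqP uY]; rewrite /preimage/= ZE// /N/= subr_ge0 lerBlDl; split.
  by move=> [Yu [uYx Bu]]; rewrite uYx lt_neqAle eq_sym uY Yu.
by move=> [/andP[/ltW Yu uYx] Bu].
Qed.

End Compensator.

(** * Sample paths of the threshold policy *)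

Definition has_min (R : realType) (E : set R) := exists2 m, E m & forall e, E e -> m <= e.

Lemma has_min_inf (R : realType) (E : set R) : has_min E -> E (inf E).
Proof.
move=> [m Em mE]; rewrite (_ : inf E = m)//; apply/eqP; rewrite eq_le; apply/andP; split.
  by apply: ge_inf => //; exists m.
by apply: lb_le_inf => //; exists m.
Qed.

Lemma has_minU (R : realType) (E F : set R) :
  (F !=set0 -> has_min F) -> has_min E -> has_min (E `|` F).
Proof.
move=> hF [m Em mE]; have [/hF[p Fp pF]|F0] := pselect (F !=set0); last first.
  by exists m => [|e [/mE//|Fe]]; [left|case: F0; exists e].
exists (Num.min m p); first by rewrite minElt; case: ifP => _; [left|right].
by move=> e [/mE|/pF]; rewrite ge_min => ->; rewrite ?orbT.
Qed.

(** An infimum over epochs is attained even if the unscheduled opportunities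
    accumulate, because they are enumerated in increasing order. *)
Lemma has_min_nondecreasing (R : realType) (f : nat -> R) (E : set R) :
  {homo f : m n / (m <= n)%N >-> m <= n} ->
  E `<=` range f -> E !=set0 -> has_min E.
Proof.
move=> fle Ef [e Ee].
have ex : exists n, `[< E (f n) >].
  by have [n _ fn] := Ef _ Ee; exists n; apply/asboolP; rewrite fn.
case: (ex_minnP ex) => n /asboolP En nmin; exists (f n) => // y Ey.
have [p _ fp] := Ef _ Ey; rewrite -fp; apply: fle; apply: nmin.
by apply/asboolP; rewrite fp.
Qed.

Section Paths.
Context {R : realType} (tau ttilde : R).
Implicit Types xi : clock -> R.

Definition sojourn2 xi k := xi (inl (inl k)).
Definition sojourn1 xi k := xi (inl (inr k)).
Definition gap xi n := xi (inr n).

Definition installed xi k :=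
  installation_time tau (threshold_policy ttilde) (sojourn2 xi) (sojourn1 xi) (gap xi) k.
Definition degraded xi k := installed xi k + sojourn2 xi k.
Definition failing xi k := degraded xi k + sojourn1 xi k.
(** Partial sums of the gaps: the opportunities are the [uso xi n.+1]. *)
Definition uso xi n := \sum_(i < n) gap xi i.
(** The times at which the policy uses an unscheduled opportunity on a satisfactory
    component. *)
Definition uso_window t := ttilde < remaining_time tau t.
(** The epochs at which a satisfactory component would be replaced. *)
Definition replacement_epoch xi e :=
  epochs tau (gap xi) SO e \/ epochs tau (gap xi) USO e /\ uso_window e.
(** Almost every path is of this kind; restricting the events below to such paths
    makes the pathwise identities hold without exception. *)
Definition positive_path xi := forall i, 0 < xi i.

Lemma replacing_epochsP x2 x1 w k s o t :
  replacing_epochs tau (threshold_policy ttilde) x2 x1 w k s o t <->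
  [/\ s < t, s + x2 k <= t, t < s + (x2 k + x1 k), epochs tau w o t &
      o = USO -> uso_window t].
Proof.
rewrite /replacing_epochs /condition_at_age /= !ltrBlDl.
have [t2|t2] := ltP t (s + x2 k).
  by split => [[_ _]|[]//]; rewrite /threshold_policy.
have [t1|t1] := ltP t (s + (x2 k + x1 k)); last by split => [[/andP[]]|[]].
rewrite /threshold_policy; case: o.
  by split => [[/andP[]]|[-> _ _ eo _]].
rewrite /uso_window; case: ifP => h; first by split => [[/andP[]]|[-> _ _ eo _]].
by split => [[]//|[_ _ _ _ /(_ erefl)]].
Qed.

Lemma replacement_epoch_replacing xi k s t : s < t -> s + sojourn2 xi k <= t ->
  t < s + (sojourn2 xi k + sojourn1 xi k) -> replacement_epoch xi t ->
  exists o, replacing_epochs tau (threshold_policy ttilde) (sojourn2 xi)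
    (sojourn1 xi) (gap xi) k s o t.
Proof.
by move=> st s2 s1 [eo|[eo use]]; [exists SO|exists USO]; apply/replacing_epochsP.
Qed.

Lemma replacing_replacement_epoch xi k s o t :
  replacing_epochs tau (threshold_policy ttilde) (sojourn2 xi)
    (sojourn1 xi) (gap xi) k s o t -> replacement_epoch xi t.
Proof.
by case: o => /replacing_epochsP[_ _ _ eo use]; [left|right; split => //; exact: use].
Qed.

Hypothesis tau_gt0 : 0 < tau.

Lemma le_uso xi m n : positive_path xi -> (m <= n)%N -> uso xi m <= uso xi n.
Proof.
move=> g mn; rewrite -(subnKC mn); elim: (n - m)%N => [|p ih]; first by rewrite addn0.
rewrite addnS {2}/uso big_ord_recr/=; apply: (le_trans ih).
by rewrite lerDl; apply: ltW; exact: g.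
Qed.

Lemma lt_uso xi m n : positive_path xi -> (m < n)%N -> uso xi m < uso xi n.
Proof.
move=> g mn; apply: lt_le_trans (le_uso g mn).
by rewrite {2}/uso big_ord_recr/= ltrDl; exact: g.
Qed.

(** These four properties characterize the removal time as the minimum of the
    failure time and of the first replacement epoch from the degradation time on; all
    pathwise arguments rest on them, not on the infimum that defines it. *)
Lemma removal_spec xi k : positive_path xi ->
  [/\ degraded xi k <= installed xi k.+1, installed xi k.+1 <= failing xi k,
   (forall e, replacement_epoch xi e -> degraded xi k <= e -> e < failing xi k ->
      installed xi k.+1 <= e) &
   installed xi k.+1 = failing xi k \/
   (replacement_epoch xi (installed xi k.+1) /\ installed xi k.+1 < failing xi k)].
Proof.
move=> g; set s := installed xi k.
pose Rep := replacing_epochs tau (threshold_policy ttilde) (sojourn2 xi)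
  (sojourn1 xi) (gap xi) k s.
pose E := [set s + (sojourn2 xi k + sojourn1 xi k)] `|` (Rep SO `|` Rep USO).
have iE : installed xi k.+1 = inf E by [].
have minE : has_min E.
  rewrite /E setUA; apply: has_minU; last apply: has_minU.
  - apply: (@has_min_nondecreasing _ (fun n => uso xi n.+1)).
      by move=> m n mn; apply: le_uso.
    by move=> e /replacing_epochsP[_ _ _ [n ->] _]; exists n.
  - apply: (@has_min_nondecreasing _ (fun n => n.+1%:R * tau)).
      by move=> m n mn; rewrite ler_pM2r// ler_nat.
    by move=> e /replacing_epochsP[_ _ _ [n ->] _]; exists n.
  - by exists (s + (sojourn2 xi k + sojourn1 xi k)) => // e ->.
have Einf := has_min_inf minE; have lb e : E e -> installed xi k.+1 <= e.
  by move=> Ee; rewrite iE; apply: ge_inf => //; case: minE => m _ mE; exists m.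
have failE : failing xi k = s + (sojourn2 xi k + sojourn1 xi k) by rewrite /failing addrA.
split.
- rewrite iE; move: Einf => [->|[|] /replacing_epochsP[]//].
  by rewrite addrA lerDl; apply: ltW; exact: g.
- by rewrite failE; apply: lb; left.
- move=> e ue de ef; apply: lb; right.
  have [||||[] Re] := @replacement_epoch_replacing xi k s e => //.
  + by apply: lt_le_trans de; rewrite ltrDl; exact: g.
  + by rewrite -failE.
  + by left.
  + by right.
- rewrite iE failE; move: Einf => [|[|] Re]; first by left.
  + by right; split; [exact: replacing_replacement_epoch Re|case/replacing_epochsP: Re].
  + by right; split; [exact: replacing_replacement_epoch Re|case/replacing_epochsP: Re].
Qed.

(** A replacing epoch precedes the failure time strictly, so the cause can be read
    off from the removal time alone. *)
Lemma removal_causeE xi k : positive_path xi ->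
  removal_cause tau (threshold_policy ttilde) (sojourn2 xi) (sojourn1 xi) (gap xi) k =
  if installed xi k.+1 == failing xi k then corrective
  else if `[< epochs tau (gap xi) SO (installed xi k.+1) >] then preventive SO
  else preventive USO.
Proof.
move=> g; have [d f _ c] := removal_spec k g.
have inst_gt : installed xi k < installed xi k.+1.
  by apply: lt_le_trans d; rewrite ltrDl; exact: g.
rewrite /removal_cause -/(installed xi k).
rewrite -/(removal_time _ _ _ _ _ _ _) -[removal_time _ _ _ _ _ _ _]/(installed xi k.+1).
have fE : failing xi k = installed xi k + (sojourn2 xi k + sojourn1 xi k).
  by rewrite /failing addrA.
have [if_|nif] := eqVneq.
  by rewrite !memNset// => /replacing_epochsP[_ _]; rewrite -fE -if_ ltxx.
have {}f : installed xi k.+1 < failing xi k by rewrite lt_neqAle nif.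
have {}c : replacement_epoch xi (installed xi k.+1) by case: c => [ci|[]//]; rewrite ci eqxx in nif.
case: asboolP => [so|nso].
  by rewrite mem_set//; apply/replacing_epochsP; rewrite -fE.
rewrite memNset; last by case/replacing_epochsP.
case: c => [//|[eo u]]; rewrite mem_set//; apply/replacing_epochsP.
by rewrite -fE.
Qed.

End Paths.

(** * Effect of changing one clock on a path *)

Section Perturbed.
Context {R : realType} (tau ttilde : R).
Hypothesis tau_gt0 : 0 < tau.
Implicit Types xi : path_space R.
Local Notation installed := (@installed R tau ttilde).
Local Notation degraded := (@degraded R tau ttilde).
Local Notation failing := (@failing R tau ttilde).
Local Notation replacement_epoch := (@replacement_epoch R tau ttilde).
Local Notation uso_window := (@uso_window R tau ttilde).
Local Notation upd := with_coordinate.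

(** Component k is installed at a time that only depends on the earlier components
    and on the opportunities. *)
Lemma installed_ext xi xi' k :
  (forall j, (j < k)%N -> sojourn2 xi j = sojourn2 xi' j) ->
  (forall j, (j < k)%N -> sojourn1 xi j = sojourn1 xi' j) ->
  gap xi = gap xi' -> installed xi k = installed xi' k.
Proof.
move=> e2 e1 eg; elim: k e2 e1 => // k ih e2 e1.
have {}ih : installed xi k = installed xi' k.
  by apply: ih => j jk; [apply: e2|apply: e1]; exact: ltnW.
rewrite -[LHS]/(removal_time _ _ _ _ _ _ (installed xi k)).
rewrite -[RHS]/(removal_time _ _ _ _ _ _ (installed xi' k)) ih.
by rewrite /removal_time /replacing_epochs /condition_at_age eg e1// e2.
Qed.

Lemma positive_path_upd xi i x : 0 < x -> x <= xi i ->
  positive_path (upd xi i x) <-> positive_path xi.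
Proof.
move=> x0 xi_; split => g j; last by rewrite /upd; case: eqP.
have := g j; rewrite /upd; case: eqP => // -> _; exact: lt_le_trans xi_.
Qed.

Lemma installed_upd2 xi k x : installed (upd xi (inl (inl k)) x) k = installed xi k.
Proof.
apply: installed_ext => // j jk; rewrite /sojourn2 /upd.
by case: eqP => // -[ejk]; rewrite ejk ltnn in jk.
Qed.

Lemma degraded_upd2 xi k x :
  degraded (upd xi (inl (inl k)) x) k = installed xi k + x.
Proof. by rewrite /degraded installed_upd2 /sojourn2 /upd eqxx. Qed.

Lemma degraded_upd1 xi k x : degraded (upd xi (inl (inr k)) x) k = degraded xi k.
Proof.
rewrite /degraded; congr (_ + _); apply: installed_ext => // j jk.
rewrite /sojourn1 /upd; by case: eqP => // -[ejk]; rewrite ejk ltnn in jk.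
Qed.

Lemma failing_upd1 xi k x : failing (upd xi (inl (inr k)) x) k = degraded xi k + x.
Proof. by rewrite /failing degraded_upd1 /sojourn1 /upd eqxx. Qed.

(** If the second sojourn were cut short at time u, the component would fail at u
    exactly when nothing has removed it before u: the epochs before u are the same
    on both paths. *)
Lemma fails_upd1 xi k u : positive_path xi -> degraded xi k < u -> u <= failing xi k ->
  let xi' := upd xi (inl (inr k)) (u - degraded xi k) in
  installed xi' k.+1 = failing xi' k <-> u <= installed xi k.+1.
Proof.
move=> g du uf xi'.
have g' : positive_path xi'.
  by apply/positive_path_upd => //; rewrite ?subr_gt0// lerBlDl.
have f'E : failing xi' k = u by rewrite failing_upd1 subrKC.
have [d f h c] := removal_spec ttilde tau_gt0 k g.
have [d' f' h' c'] := removal_spec ttilde tau_gt0 k g'.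
have uE e : replacement_epoch xi' e <-> replacement_epoch xi e by [].
rewrite degraded_upd1 f'E in d' f' h' c' *.
split => [iu|ui].
  rewrite leNgt; apply/negP => iu'.
  case: c => [cE|[ue _]]; first by rewrite cE ltNge uf in iu'.
  by have := h' _ ue d iu'; rewrite iu leNgt iu'.
case: c' => // -[/uE ue iu].
have := h _ ue d' (lt_le_trans iu uf).
by rewrite leNgt (lt_le_trans iu ui).
Qed.

(** Causality: the process up to time u only depends on the epochs before u. *)
Lemma installed_causal xi xi' u k : positive_path xi -> positive_path xi' ->
  sojourn2 xi = sojourn2 xi' -> sojourn1 xi = sojourn1 xi' ->
  (forall e, e < u -> replacement_epoch xi e <-> replacement_epoch xi' e) ->
  installed xi k < u -> installed xi' k = installed xi k.
Proof.
move=> g g' e2 e1 ue iu.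
(* The claim is symmetric in the two paths; the induction carries both directions
   because each inequality uses the other one at earlier components. *)
suff main m (zeta zeta' : path_space R) : positive_path zeta -> positive_path zeta' ->
    sojourn2 zeta = sojourn2 zeta' -> sojourn1 zeta = sojourn1 zeta' ->
    (forall e, e < u -> replacement_epoch zeta e -> replacement_epoch zeta' e) ->
    (forall j, (j <= m)%N -> installed zeta j < u -> installed zeta' j = installed zeta j) ->
    installed zeta m.+1 < u -> installed zeta' m.+1 <= installed zeta m.+1.
  suff : forall j, (j <= k)%N ->
      (installed xi j < u -> installed xi' j = installed xi j) /\
      (installed xi' j < u -> installed xi j = installed xi' j).
    by move=> /(_ k (leqnn _)) [/(_ iu)].
  have ue1 e : e < u -> replacement_epoch xi e -> replacement_epoch xi' e by move=> /ue[].
  have ue2 e : e < u -> replacement_epoch xi' e -> replacement_epoch xi e by move=> /ue[].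
  elim: {iu}k => [|k ih]; first by case.
  move=> j; rewrite leq_eqVlt => /predU1P[->|/ih//].
  have m1 := main k _ _ g g' e2 e1 ue1 (fun j jk => (ih j jk).1).
  have m2 := main k _ _ g' g (esym e2) (esym e1) ue2 (fun j jk => (ih j jk).2).
  split => iu.
    apply/eqP; rewrite eq_le m1//= m2//; exact: le_lt_trans (m1 iu) iu.
  apply/eqP; rewrite eq_le m2//= m1//; exact: le_lt_trans (m2 iu) iu.
move=> {}g {}g' {}e2 {}e1 {}ue ih im.
have [d f h c] := removal_spec ttilde tau_gt0 m g.
have [d' f' h' c'] := removal_spec ttilde tau_gt0 m g'.
have imd : installed zeta m < degraded zeta m by rewrite ltrDl; exact: g.
have ii : installed zeta' m = installed zeta m.
  by apply: ih => //; apply: lt_trans imd (le_lt_trans d im).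
have dd : degraded zeta' m = degraded zeta m by rewrite /degraded ii e2.
have ff : failing zeta' m = failing zeta m by rewrite /failing dd e1.
case: c => [->|[uz iz]]; first by rewrite -ff.
by apply: h' => //; [exact: ue|rewrite dd|rewrite ff].
Qed.

Lemma uso_upd xi n m x : (m <= n)%N -> uso (upd xi (inr n) x) m = uso xi m.
Proof.
move=> mn; apply: eq_bigr => i _; rewrite /gap /upd; case: eqP => // -[ein].
by have := ltn_ord i; rewrite ein ltnNge mn.
Qed.

Lemma uso_upd_next xi n x : uso (upd xi (inr n) x) n.+1 = uso xi n + x.
Proof. by rewrite /uso big_ord_recr/= -/(uso _ n) uso_upd// /gap /upd eqxx. Qed.

Lemma replacement_epoch_before xi xi' n u e : positive_path xi -> 
  (forall m, (m <= n)%N -> uso xi' m = uso xi m) -> 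
  u <= uso xi n.+1 -> e < u -> replacement_epoch xi e -> replacement_epoch xi' e.
Proof.
move=> g vv un eu [so|[[m em] use]]; [by left|right; split => //].
exists m; rewrite em; apply/esym/vv; rewrite ltnNge; apply/negP => nm.
by move: eu; rewrite em ltNge (le_trans un)//; exact: le_uso.
Qed.

(** Moving the next unscheduled opportunity forward to u leaves the process before
    u unchanged, so it removes component k exactly if that component is satisfactory
    at u and the policy uses opportunities at that time.  The exceptional values of u
    are those where two events would coincide. *)
Lemma opportunity_upd xi n k u : positive_path xi -> uso xi n < u -> u <= uso xi n.+1 ->
  ~ (exists m : nat, u = m.+1%:R * tau) -> u <> degraded xi k -> u <> installed xi k.+1 ->
  let xi' := upd xi (inr n) (u - uso xi n) in
  [/\ installed xi' k.+1 < failing xi' k,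
      ~ epochs tau (gap xi') SO (installed xi' k.+1) & installed xi' k.+1 = uso xi' n.+1]
  <-> uso_window u /\ degraded xi k <= u < installed xi k.+1.
Proof.
move=> g nu un nso ud ui xi'.
have g' : positive_path xi'.
  apply/positive_path_upd => //; first by rewrite subr_gt0.
  by rewrite lerBlDl; move: un; rewrite /uso big_ord_recr.
have uE : uso xi' n.+1 = u by rewrite uso_upd_next subrKC.
have [d f h c] := removal_spec ttilde tau_gt0 k g.
have [d' f' h' c'] := removal_spec ttilde tau_gt0 k g'.
have ue e : e < u -> replacement_epoch xi e <-> replacement_epoch xi' e.
  move=> eu; split; apply: (@replacement_epoch_before _ _ n u) => //.
  - by move=> m mn; rewrite uso_upd.
  - by move=> m mn; rewrite uso_upd.
  - by rewrite uE.
have ue' e : e < u -> replacement_epoch xi' e <-> replacement_epoch xi e by move=> /ue ->.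
have same m : installed xi m < u -> installed xi' m = installed xi m.
  exact: installed_causal.
have same' m : installed xi' m < u -> installed xi m = installed xi' m.
  exact: installed_causal.
have id_ : installed xi k < degraded xi k by rewrite ltrDl; exact: g.
have id' : installed xi' k < degraded xi' k by rewrite ltrDl; exact: g'.
rewrite uE; split.
  move=> [if' _ iu].
  have use : uso_window u.
    case: c' => [cf|[[so|[_]]]]; first by rewrite cf ltxx in if'.
      by case: nso; rewrite -iu.
    by rewrite iu.
  have ii : installed xi k = installed xi' k.
    by apply: same'; rewrite -iu; apply: lt_le_trans id' d'.
  have dd : degraded xi k = degraded xi' k by rewrite /degraded ii.
  split => //; apply/andP; split; first by rewrite dd -iu.
  rewrite ltNge le_eqVlt; apply/negP => /predU1P[iu2|iu2]; first exact/ui/esym.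
  by move: (iu2); rewrite -(same _ iu2) iu ltxx.
move=> [use /andP[du ui2]].
have {du}du : degraded xi k < u by rewrite lt_neqAle du andbT eq_sym; exact/eqP.
have ii : installed xi' k = installed xi k.
  by apply: same; exact: lt_trans id_ du.
have dd : degraded xi' k = degraded xi k by rewrite /degraded ii.
have ff : failing xi' k = failing xi k by rewrite /failing dd.
have uf : u < failing xi' k by rewrite ff; exact: lt_le_trans f.
have iu : installed xi' k.+1 = u.
  apply/eqP; rewrite eq_le; apply/andP; split.
    apply: h' => //; last by rewrite dd ltW.
    by right; split => //; exists n; rewrite -uE.
  rewrite leNgt; apply/negP => iu.
  by have := same' _ iu => iE; move: iu; rewrite -iE ltNge ltW.
by rewrite iu.
Qed.

End Perturbed.

(** * Measurability of the replacement process *)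

Section Measurability.
Context {R : realType} (tau ttilde : R).
Hypothesis tau_gt0 : 0 < tau.
Implicit Types xi : path_space R.
Local Notation installed := (@installed R tau ttilde).
Local Notation degraded := (@degraded R tau ttilde).
Local Notation failing := (@failing R tau ttilde).
Local Notation uso_window := (@uso_window R tau ttilde).
Local Notation pol := (threshold_policy ttilde).

Lemma measurable_remaining_time : measurable_fun setT (remaining_time tau).
Proof.
rewrite /remaining_time; apply: measurable_funB; last exact: measurable_id.
apply: nondecreasing_measurable => // x y xy; rewrite ler_pM2r// ler_int lerD2r.
by apply: le_floor; rewrite ler_pM2r// invr_gt0.
Qed.

Lemma measurable_uso_window : measurable [set u | uso_window u].
Proof. by apply: measurable_set_lt => //; exact: measurable_remaining_time. Qed.

Lemma measurable_sojourn2 k : measurable_fun setT (fun xi : path_space R => sojourn2 xi k).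
Proof. exact: measurable_coordinate. Qed.

Lemma measurable_sojourn1 k : measurable_fun setT (fun xi : path_space R => sojourn1 xi k).
Proof. exact: measurable_coordinate. Qed.

Lemma measurable_uso n : measurable_fun setT (fun xi : path_space R => uso xi n).
Proof. by apply: measurable_sum => i; exact: measurable_coordinate. Qed.

Lemma measurable_positive_path : measurable [set xi : path_space R | positive_path xi].
Proof.
have m i : measurable [set xi : path_space R | 0 < xi i].
  by apply: measurable_set_lt => //; exact: (@measurable_coordinate R i).
rewrite (_ : mkset _ = (\bigcap_k [set xi : path_space R | 0 < xi (inl (inl k))]) `&`
  ((\bigcap_k [set xi : path_space R | 0 < xi (inl (inr k))]) `&`
    \bigcap_k [set xi : path_space R | 0 < xi (inr k)])).
  apply: measurableI; first exact: bigcapT_measurable.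
  by apply: measurableI; exact: bigcapT_measurable.
apply/seteqP; split => [xi g|xi [h1 [h2 h3]] [[k|k]|k]].
- by split => [k _|]; [exact: g|split => [k _|k _]; exact: g].
- exact: h1.
- exact: h2.
- exact: h3.
Qed.

Lemma measurable_epochs o (g : path_space R -> R) : measurable_fun setT g ->
  measurable [set xi : path_space R | epochs tau (gap xi) o (g xi)].
Proof.
move=> mg; rewrite (_ : mkset _ = \bigcup_n [set xi : path_space R | g xi =
    if o is SO then n.+1%:R * tau else uso xi n.+1]).
  apply: bigcupT_measurable => n; apply: measurable_set_eq => //.
  by case: o => //; exact: measurable_uso.
by case: o; apply/seteqP; split => [xi [n]|xi [n _]]; exists n.
Qed.

Lemma measurable_replacing k o (s g : path_space R -> R) :
  measurable_fun setT s -> measurable_fun setT g ->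
  measurable [set xi : path_space R | replacing_epochs tau pol (sojourn2 xi) (sojourn1 xi) (gap xi)
                         k (s xi) o (g xi)].
Proof.
move=> ms mg; have m2 := measurable_sojourn2 k; have m1 := measurable_sojourn1 k.
rewrite (_ : mkset _ = [set xi : path_space R | s xi < g xi] `&`
  ([set xi : path_space R | s xi + sojourn2 xi k <= g xi] `&`
  ([set xi : path_space R | g xi < s xi + (sojourn2 xi k + sojourn1 xi k)] `&`
  ([set xi : path_space R | epochs tau (gap xi) o (g xi)] `&`
   if o is SO then setT else [set xi : path_space R | uso_window (g xi)])))); last first.
  apply/seteqP; split => xi /=; rewrite replacing_epochsP.
    move=> [h1 h2 h3 h4 u]; do 4 split => //.
    by case: o {h4} u => // /(_ erefl).
  by case: o => -[h1 [h2 [h3 []]]].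
apply: measurableI; first exact: measurable_set_lt.
apply: measurableI; first by apply: measurable_set_le => //; exact: measurable_funD.
apply: measurableI.
  apply: measurable_set_lt => //.
  by apply: measurable_funD => //; exact: measurable_funD.
apply: measurableI; first exact: measurable_epochs.
case: o => //; exact: (measurable_set_preimage (f := g) mg measurable_uso_window).
Qed.

Lemma le_infP (E : set R) (c : R) : has_inf E -> c <= inf E <-> lbound E c.
Proof.
move=> [E0 lbE]; split => [cE e Ee|cE]; last exact: lb_le_inf.
by apply: (le_trans cE); exact: ge_inf.
Qed.

(** The set where the removal time is at least c is a countable intersection, over
    the epochs, of the condition that an epoch which replaces is at least c. *)
Lemma measurable_installed k : measurable_fun setT (fun xi : path_space R => installed xi k).
Proof.
elim: k => [|k ih]; first exact: measurable_cst.
apply: (measurability (@RGenCInfty.G R)); first exact: RGenCInfty.measurableE.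
move=> _ [_ [c ->] <-]; rewrite setTI.
pose fail xi := installed xi k + (sojourn2 xi k + sojourn1 xi k).
pose rep xi o := replacing_epochs tau pol (sojourn2 xi) (sojourn1 xi) (gap xi)
                         k (installed xi k) o.
have mfail : measurable_fun setT fail.
  apply: measurable_funD => //; apply: measurable_funD.
    exact: measurable_sojourn2.
  exact: measurable_sojourn1.
have mrep o (e : nat -> path_space R -> R) : (forall n, measurable_fun setT (e n)) ->
    measurable (\bigcap_n ([set xi : path_space R | c <= e n xi] `|`
      ~` [set xi : path_space R | rep xi o (e n xi)])).
  move=> me; apply: bigcapT_measurable => n; apply: measurableU.
    exact: measurable_set_le.
  by apply: measurableC; exact: measurable_replacing.
rewrite (_ : _ @^-1` _ = [set xi : path_space R | c <= fail xi] `&`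
  ((\bigcap_n ([set xi : path_space R | c <= n.+1%:R * tau] `|`
      ~` [set xi : path_space R | rep xi SO (n.+1%:R * tau)])) `&`
   (\bigcap_n ([set xi : path_space R | c <= uso xi n.+1] `|`
      ~` [set xi : path_space R | rep xi USO (uso xi n.+1)])))).
  apply: measurableI; first exact: measurable_set_le.
  apply: measurableI; first by apply: (mrep SO (fun n _ => n.+1%:R * tau)).
  by apply: (mrep USO (fun n xi => uso xi n.+1)) => n; exact: measurable_uso.
have hE xi : has_inf ([set fail xi] `|` (rep xi SO `|` rep xi USO)).
  split; first by exists (fail xi); left.
  exists (Num.min (fail xi) (installed xi k)) => e [->|[|] /replacing_epochsP[lt _ _ _ _]].
  - by rewrite ge_min lexx.
  - by rewrite ge_min (ltW lt) orbT.
  - by rewrite ge_min (ltW lt) orbT.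
apply/seteqP; split => xi; rewrite /preimage/= in_itv/= andbT
    -[removal_time _ _ _ _ _ _ _]/(inf ([set fail xi] `|` (rep xi SO `|` rep xi USO))).
  rewrite le_infP// => lb; split; first by apply: lb; left.
  split => n _ /=.
    by have [r|] := pselect (rep xi SO (n.+1%:R * tau)); [left; apply: lb; right; left|right].
  by have [r|] := pselect (rep xi USO (uso xi n.+1)); [left; apply: lb; right; right|right].
move=> [cf [cso cuso]]; rewrite le_infP// => e [->//|[re|re]].
  have [_ _ _ [n en] _] := (replacing_epochsP _ _ _ _ _ _ _ _ _).1 re.
  by rewrite en; have [//|] := cso n I; rewrite /= -en.
have [_ _ _ [n en] _] := (replacing_epochsP _ _ _ _ _ _ _ _ _).1 re.
by rewrite en; have [//|] := cuso n I; rewrite /= /uso -en.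
Qed.

Lemma measurable_degraded k : measurable_fun setT (fun xi : path_space R => degraded xi k).
Proof.
by apply: measurable_funD; [exact: measurable_installed|exact: measurable_sojourn2].
Qed.

Lemma measurable_failing k : measurable_fun setT (fun xi : path_space R => failing xi k).
Proof.
by apply: measurable_funD; [exact: measurable_degraded|exact: measurable_sojourn1].
Qed.

Lemma measurable_asbool d (T : measurableType d) (P : T -> Prop) :
  measurable [set x | P x] -> measurable_fun setT (fun x => `[< P x >]).
Proof.
move=> mP; apply: (measurable_fun_bool true); rewrite setTI.
by rewrite (_ : _ @^-1` _ = [set x | P x])//; apply/seteqP; split => x /= /asboolP.
Qed.

Lemma measurable_total_cost cc cso cuso T :
  0 <= cc -> 0 <= cso -> 0 <= cuso -> measurable_fun setT (fun xi : path_space R =>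
    total_cost tau pol (sojourn2 xi) (sojourn1 xi) (gap xi) cc cso cuso T).
Proof.
move=> cc0 cso0 cuso0.
apply: ge0_emeasurable_sum => [k xi _ _|k _].
  rewrite lee_fin; case: ifP => // _; rewrite /cause_cost.
  by case: removal_cause => // -[].
apply/measurable_EFinP; apply: measurable_fun_ifT => //.
  by apply: measurable_fun_ler => //; exact: (measurable_installed k.+1).
have -> : (fun xi : path_space R => cause_cost cc cso cuso
    (removal_cause tau pol (sojourn2 xi) (sojourn1 xi) (gap xi) k)) =
  (fun xi : path_space R =>
  if installed xi k.+1 \in replacing_epochs tau pol (sojourn2 xi) (sojourn1 xi) (gap xi) k
         (installed xi k) SO then cso
  else if installed xi k.+1 \in replacing_epochs tau pol (sojourn2 xi) (sojourn1 xi) (gap xi) k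
         (installed xi k) USO then cuso else cc).
  apply/funext => xi; rewrite /removal_cause /installed/=.
  by case: ifP => // _; case: ifP.
apply: measurable_fun_ifT => //; last apply: measurable_fun_ifT => //.
  exact: (measurable_asbool (measurable_replacing k SO
            (measurable_installed k) (measurable_installed k.+1))).
exact: (measurable_asbool (measurable_replacing k USO
          (measurable_installed k) (measurable_installed k.+1))).
Qed.

End Measurability.

(** * Expected numbers of events *)

Arguments installed : simpl never.

Section Rates.
Context {R : realType} (tau ttilde mu1 mu2 lambda : R).
Hypotheses (tau_gt0 : 0 < tau) (mu1_gt0 : 0 < mu1) (mu2_gt0 : 0 < mu2)
  (lambda_gt0 : 0 < lambda).

Definition clock_rate (i : clock) : R :=
  match i with inl (inl _) => mu2 | inl (inr _) => mu1 | inr _ => lambda end.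

Variable L : probability (path_space R) R.
Hypothesis indep : independent_exponentials L clock_rate.
Implicit Types xi : path_space R.
Local Notation installed := (@installed R tau ttilde).
Local Notation degraded := (@degraded R tau ttilde).
Local Notation failing := (@failing R tau ttilde).
Local Notation uso_window := (@uso_window R tau ttilde).
Local Notation pol := (threshold_policy ttilde).
Local Notation leb := (@lebesgue_measure R).
Local Open Scope ereal_scope.

Lemma clock_rate_gt0 i : (0 < clock_rate i)%R.
Proof. by case: i => [[]|]. Qed.

Definition perfect_at k u :=
  [set xi : path_space R | positive_path xi /\ (installed xi k <= u < degraded xi k)%R].
Definition satisfactory_at k u :=
  [set xi : path_space R | positive_path xi /\ (degraded xi k <= u < installed xi k.+1)%R].

Definition installed_by k t :=
  [set xi : path_space R | positive_path xi /\ (installed xi k <= t)%R].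
Definition degraded_by k t :=
  [set xi : path_space R | positive_path xi /\ (degraded xi k <= t)%R].
Definition between_usos n u :=
  [set xi : path_space R | positive_path xi /\ (uso xi n < u <= uso xi n.+1)%R].

Lemma measurable_joint_le (f : path_space R -> R) (g : path_space R * R -> R) :
  measurable_fun setT f -> measurable_fun setT g ->
  measurable [set p : path_space R * R | (f p.1 <= g p)%R].
Proof.
move=> mf mg; apply: measurable_set_le => //.
exact: (measurableT_comp mf measurable_fst).
Qed.

Lemma measurable_joint_lt (f : path_space R -> R) (g : path_space R * R -> R) :
  measurable_fun setT f -> measurable_fun setT g ->
  measurable [set p : path_space R * R | (g p < f p.1)%R].
Proof.
move=> mf mg; apply: measurable_set_lt => //.
exact: (measurableT_comp mf measurable_fst).
Qed.

Lemma measurable_joint_positive_path :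
  measurable [set p : path_space R * R | positive_path p.1].
Proof. exact: (measurable_set_preimage measurable_fst (@measurable_positive_path R)). Qed.

Lemma measurable_perfect_at k :
  measurable [set p : path_space R * R | perfect_at k p.2 p.1].
Proof.
apply: measurableI; first exact: measurable_joint_positive_path.
rewrite (_ : (fun x => _) = [set p : path_space R * R | (installed p.1 k <= p.2)%R] `&`
  [set p : path_space R * R | (p.2 < degraded p.1 k)%R]).
  apply: measurableI.
    apply: (measurable_joint_le (f := fun xi => installed xi k) (g := snd)).
      exact: measurable_installed.
    exact: measurable_snd.
  apply: (measurable_joint_lt (f := fun xi => degraded xi k) (g := snd)).
    exact: measurable_degraded.
  exact: measurable_snd.
by apply/seteqP; split => p /andP.
Qed.

Lemma measurable_satisfactory_at k :
  measurable [set p : path_space R * R | satisfactory_at k p.2 p.1].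
Proof.
apply: measurableI; first exact: measurable_joint_positive_path.
rewrite (_ : (fun x => _) = [set p : path_space R * R | (degraded p.1 k <= p.2)%R] `&`
  [set p : path_space R * R | (p.2 < installed p.1 k.+1)%R]).
  apply: measurableI.
    apply: (measurable_joint_le (f := fun xi => degraded xi k) (g := snd)).
      exact: measurable_degraded.
    exact: measurable_snd.
  apply: (measurable_joint_lt (f := fun xi => installed xi k.+1) (g := snd)).
    exact: measurable_installed.
  exact: measurable_snd.
by apply/seteqP; split => p /andP.
Qed.

Lemma installed_ge0 xi k : positive_path xi -> (0 <= installed xi k)%R.
Proof.
move=> g; elim: k => // k ih; have [d _ _ _] := removal_spec ttilde tau_gt0 k g.
by apply: le_trans d; apply: addr_ge0 => //; apply: ltW; exact: g.
Qed.

Lemma degraded_ge0 xi k : positive_path xi -> (0 <= degraded xi k)%R.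
Proof. by move=> g; apply: addr_ge0 (installed_ge0 k g) (ltW _); exact: g. Qed.

(** The form in which the compensator formula is used: M describes the states and times
    at which a ring of clock i triggers the event B, and t is the horizon. *)
Lemma compensator_upto i (Y : path_space R -> R) (B : set (path_space R))
    (M : set (path_space R * R)) (t : R) :
  measurable B -> measurable M -> (forall xi u, M (xi, u) -> (0 <= u)%R) ->
  (forall xi, exists2 Z : set R, countable Z & forall u, ~ Z u ->
     (M (xi, u) /\ (u <= t)%R <->
      (Y xi < u <= Y xi + xi i)%R /\ B (with_coordinate xi i (u - Y xi)))) ->
  L B = (clock_rate i)%:E * \int[leb]_(u in `[0%R, t]) L [set xi | M (xi, u)].
Proof.
move=> mB mM M0 MB.
rewrite (compensator clock_rate_gt0 indep (i := i) (Y := Y) mB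
  (M := M `&` [set p | (p.2 <= t)%R])).
- congr (_ * _); rewrite [RHS]integral_mkcond; apply: eq_integral => u _.
  rewrite patchE mem_setE in_itv/=; case: ifPn => ut.
    by congr (L _); apply/seteqP; split => [xi []//|xi Mu]; split => //; case/andP: ut.
  rewrite (_ : mkset _ = set0) ?measure0//; apply/seteqP; split => // xi [Mu ut'].
  by apply: (negP ut); rewrite ut' (M0 xi).
- by apply: measurableI => //; apply: measurable_set_le => //; exact: measurable_snd.
- exact: MB.
Qed.

Lemma countable2 (a b : R) : countable [set a; b].
Proof. exact/finite_set_countable/finite_set2. Qed.

Lemma degraded_rate k t :
  L (degraded_by k t) =
  mu2%:E * \int[leb]_(u in `[0%R, t]) L (perfect_at k u).
Proof.
apply: (@compensator_upto (inl (inl k)) (fun xi => installed xi k) _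
  [set p | perfect_at k p.2 p.1]).
- apply: measurableI; first exact: measurable_positive_path.
  by apply: measurable_set_le => //; exact: measurable_degraded.
- exact: measurable_perfect_at.
- by move=> xi u [g /andP[iu _]]; exact: le_trans (installed_ge0 _ g) iu.
- move=> xi; exists [set installed xi k; degraded xi k]; first exact: countable2.
  move=> u /not_orP[/eqP ui /eqP ud]; rewrite /= /perfect_at /degraded_by/= degraded_upd2 subrKC.
  split.
    move=> [[g /andP[iu du]] ut]; have iu' : (installed xi k < u)%R.
      by rewrite lt_neqAle eq_sym ui.
    rewrite iu' (ltW du); do 2 split => //.
    by apply/positive_path_upd; rewrite ?subr_gt0// lerBlDl (ltW du).
  move=> [/andP[iu du] [g ut]]; split => //; split.
    by apply: ((positive_path_upd _ _).1 g); rewrite ?subr_gt0// lerBlDl.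
  by rewrite (ltW iu) lt_neqAle ud.
Qed.

Lemma failing_rate k t :
  L [set xi | positive_path xi /\ installed xi k.+1 = failing xi k /\ (installed xi k.+1 <= t)%R] =
  mu1%:E * \int[leb]_(u in `[0%R, t]) L (satisfactory_at k u).
Proof.
apply: (@compensator_upto (inl (inr k)) (fun xi => degraded xi k) _
  [set p | satisfactory_at k p.2 p.1]).
- apply: measurableI; first exact: measurable_positive_path.
  apply: measurableI.
    by apply: measurable_set_eq; [exact: measurable_installed|exact: measurable_failing].
  by apply: measurable_set_le => //; exact: measurable_installed.
- exact: measurable_satisfactory_at.
- by move=> xi u [g /andP[iu _]]; exact: le_trans (degraded_ge0 _ g) iu.
- move=> xi; exists [set degraded xi k; installed xi k.+1]; first exact: countable2.
  move=> u /not_orP[/eqP ud /eqP ui]; rewrite /= /satisfactory_at/=.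
  split.
    move=> [[g /andP[du iu]] ut]; have du' : (degraded xi k < u)%R.
      by rewrite lt_neqAle eq_sym ud.
    have uf : (u <= failing xi k)%R.
      by have [_ f _ _] := removal_spec ttilde tau_gt0 k g; rewrite (le_trans (ltW iu)).
    have fu := (fails_upd1 tau_gt0 g du' uf).2 (ltW iu).
    rewrite du' uf fu failing_upd1 subrKC; do 2 split => //.
    by apply/positive_path_upd; rewrite ?subr_gt0// lerBlDl.
  move=> [/andP[du uf] [g [fu ut]]].
  have {}g : positive_path xi by apply: ((positive_path_upd _ _).1 g); rewrite ?subr_gt0// lerBlDl.
  have := (fails_upd1 tau_gt0 g du uf).1 fu => iu.
  rewrite fu failing_upd1 subrKC in ut; split => //; split => //.
  by rewrite (ltW du) lt_neqAle ui iu.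
Qed.

Lemma measurable_between_usos n :
  measurable [set p : path_space R * R | between_usos n p.2 p.1].
Proof.
apply: measurableI; first exact: measurable_joint_positive_path.
rewrite (_ : (fun x => _) = [set p : path_space R * R | (uso p.1 n < p.2)%R] `&`
  [set p : path_space R * R | (p.2 <= uso p.1 n.+1)%R]); last first.
  by apply/seteqP; split => p /andP.
apply: measurableI.
  apply: measurable_set_lt; last exact: measurable_snd.
  exact: (measurableT_comp (@measurable_uso R n) measurable_fst).
apply: measurable_set_le; first exact: measurable_snd.
exact: (measurableT_comp (@measurable_uso R n.+1) measurable_fst).
Qed.

Lemma uso_ge0 xi n : positive_path xi -> (0 <= uso xi n)%R.
Proof. by move=> g; apply: sumr_ge0 => i _; apply: ltW; exact: g. Qed.

Lemma uso_rate n t :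
  L [set xi | positive_path xi /\ (uso xi n.+1 <= t)%R] =
  lambda%:E * \int[leb]_(u in `[0%R, t]) L (between_usos n u).
Proof.
apply: (@compensator_upto (inr n) (fun xi => uso xi n) _ [set p | between_usos n p.2 p.1]).
- apply: measurableI; first exact: measurable_positive_path.
  by apply: measurable_set_le => //; exact: measurable_uso.
- exact: measurable_between_usos.
- by move=> xi u [g /andP[iu _]]; exact: le_trans (uso_ge0 _ g) (ltW iu).
- move=> xi; exists set0 => // u _; rewrite /= uso_upd_next subrKC.
  have uE : uso xi n.+1 = (uso xi n + xi (inr n))%R by rewrite /uso big_ord_recr.
  split.
    move=> [[g nu] ut]; rewrite -uE nu; do 2 split => //; case/andP: nu => nu un.
    by apply/positive_path_upd; rewrite ?subr_gt0// lerBlDl -uE.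
  move=> [/andP[nu un] [g ut]]; split => //; split; last by rewrite nu uE.
  by apply: ((positive_path_upd _ _).1 g); rewrite ?subr_gt0// lerBlDl.
Qed.

Lemma countable_so_epochs : countable [set u : R | exists m : nat, u = (m.+1%:R * tau)%R].
Proof.
rewrite (_ : mkset _ = \bigcup_m [set (m.+1%:R * tau)%R]).
  by apply: bigcup_countable => // m _; exact: countable1.
by apply/seteqP; split => [u [m ->]|u [m _ ->]]; exists m.
Qed.

Definition opportunity_by k t := [set xi : path_space R | positive_path xi /\
  [/\ (installed xi k.+1 < failing xi k)%R,
      ~ epochs tau (gap xi) SO (installed xi k.+1) & (installed xi k.+1 <= t)%R]].

Lemma measurable_opportunity_by k t : measurable (opportunity_by k t).
Proof.
have mi := measurable_installed ttilde tau_gt0 k.+1.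
apply: measurableI; first exact: measurable_positive_path.
rewrite (_ : (fun x => _) = [set xi : path_space R | (installed xi k.+1 < failing xi k)%R] `&`
  ((~` [set xi : path_space R | epochs tau (gap xi) SO (installed xi k.+1)]) `&`
   [set xi : path_space R | (installed xi k.+1 <= t)%R])); last first.
  by apply/seteqP; split => [xi [a b c]|xi [a [b c]]]; do ! split.
apply: measurableI.
  by apply: measurable_set_lt => //; exact: measurable_failing.
apply: measurableI; first by apply: measurableC; exact: measurable_epochs.
exact: measurable_set_le.
Qed.

Lemma measurable_uso_window_at k n : measurable [set p : path_space R * R |
  uso_window p.2 /\ satisfactory_at k p.2 p.1 /\ between_usos n p.2 p.1].
Proof.
apply: measurableI.
  exact: (measurable_set_preimage measurable_snd (measurable_uso_window ttilde tau_gt0)).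
by apply: measurableI; [exact: measurable_satisfactory_at|exact: measurable_between_usos].
Qed.

Lemma opportunity_rate k n t :
  L (opportunity_by k t `&` [set xi | installed xi k.+1 = uso xi n.+1]) =
  lambda%:E * \int[leb]_(u in `[0%R, t])
    L [set xi | uso_window u /\ satisfactory_at k u xi /\ between_usos n u xi].
Proof.
apply: (@compensator_upto (inr n) (fun xi => uso xi n) _
  [set p | uso_window p.2 /\ satisfactory_at k p.2 p.1 /\ between_usos n p.2 p.1]).
- apply: measurableI; first exact: measurable_opportunity_by.
  by apply: measurable_set_eq; [exact: measurable_installed|exact: measurable_uso].
- exact: measurable_uso_window_at.
- by move=> xi u [_ [[g /andP[iu _]] _]]; exact: le_trans (degraded_ge0 _ g) iu.
- move=> xi; exists ([set degraded xi k; installed xi k.+1] `|`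
    [set u : R | exists m : nat, u = (m.+1%:R * tau)%R]).
    rewrite -bigcup2E; apply: bigcup_countable => // -[|[|m]] _ /=.
    + exact: countable2.
    + exact: countable_so_epochs.
    + exact: countable0.
  move=> u /not_orP[/not_orP[ud ui] nso].
  have uE : uso xi n.+1 = (uso xi n + xi (inr n))%R by rewrite /uso big_ord_recr.
  rewrite /= /satisfactory_at /between_usos /opportunity_by /=; split.
    move=> [[use [[g du] [_ /andP[nu un]]]] ut].
    have [_ /(_ (conj use du))[a b c]] := opportunity_upd (tau_gt0) g nu un nso ud ui.
    rewrite nu -uE un; split => //; split => //; split; last first.
      by split => //; rewrite c uso_upd_next subrKC.
    by apply/positive_path_upd; rewrite ?subr_gt0// lerBlDl -uE.
  move=> [/andP[nu un] [[g [a b ut]] c]].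
  have {}g : positive_path xi by apply: ((positive_path_upd _ _).1 g); rewrite ?subr_gt0// lerBlDl.
  rewrite c uso_upd_next subrKC in ut; rewrite -uE in un; rewrite nu un.
  have [/(_ (And3 a b c))[use du] _] := opportunity_upd tau_gt0 g nu un nso ud ui.
  by [].
Qed.

Lemma measurable_perfect_at_time k u : measurable (perfect_at k u).
Proof.
exact: (measurable_set_preimage (pair2_measurable (T1 := path_space R) (u : R))
  (measurable_perfect_at k)).
Qed.

Lemma measurable_satisfactory_at_time k u : measurable (satisfactory_at k u).
Proof.
exact: (measurable_set_preimage (pair2_measurable (T1 := path_space R) (u : R))
  (measurable_satisfactory_at k)).
Qed.

Lemma measurable_between_usos_time n u : measurable (between_usos n u).
Proof.
exact: (measurable_set_preimage (pair2_measurable (T1 := path_space R) (u : R))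
  (measurable_between_usos n)).
Qed.

Lemma measurable_installed_by k u : measurable (installed_by k u).
Proof.
apply: measurableI; first exact: measurable_positive_path.
by apply: measurable_set_le => //; exact: measurable_installed.
Qed.

Lemma measurable_degraded_by k u : measurable (degraded_by k u).
Proof.
apply: measurableI; first exact: measurable_positive_path.
by apply: measurable_set_le => //; exact: measurable_degraded.
Qed.

Lemma measurable_section_measure (M : set (path_space R * R)) : measurable M ->
  measurable_fun setT (fun u : R => L [set xi | M (xi, u)]).
Proof.
move=> mM; have := measurable_fun_ysection L mM; congr measurable_fun.
by apply/funext => u /=; congr (L _); apply/seteqP; split => xi /=; rewrite ysectionE.
Qed.

Lemma perfect_split k u :
  L (installed_by k u) = L (perfect_at k u) + L (degraded_by k u).
Proof.
rewrite -measureU//=; last 3 first.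
- exact: measurable_perfect_at_time.
- exact: measurable_degraded_by.
- by apply/seteqP; split => // xi [[_ /andP[_ ud]] [_]]; rewrite leNgt ud.
congr (L _); apply/seteqP; split => [xi [g iu]|xi [[g /andP[iu _]]//|[g du]]].
  by have [du|ud] := leP (degraded xi k) u; [right|left; split => //; rewrite iu].
by split => //; apply: le_trans du; rewrite lerDl; apply: ltW; exact: g.
Qed.

Lemma satisfactory_split k u :
  L (degraded_by k u) = L (satisfactory_at k u) + L (installed_by k.+1 u).
Proof.
rewrite -measureU//=; last 3 first.
- exact: measurable_satisfactory_at_time.
- exact: measurable_installed_by.
- by apply/seteqP; split => // xi [[_ /andP[_ ud]] [_]]; rewrite leNgt ud.
congr (L _); apply/seteqP; split => [xi [g iu]|xi [[g /andP[iu _]]//|[g du]]].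
  by have [du|ud] := leP (installed xi k.+1) u; [right|left; split => //; rewrite iu].
by split => //; apply: le_trans du; have [] := removal_spec ttilde tau_gt0 k g.
Qed.

(** Compensator formula with Y = 0: a clock never rings at a time that is both
    positive and nonpositive. *)
Lemma nonpositive_clock i : L [set xi | (xi i <= 0)%R] = 0.
Proof.
rewrite (compensator clock_rate_gt0 indep (i := i) (Y := fun=> 0%R) (M := set0)) //.
- by rewrite integral0_eq ?mule0// => u _; rewrite (_ : mkset _ = set0)// measure0.
- by apply: measurable_set_le => //; exact: (@measurable_coordinate R i).
- move=> xi; exists set0 => // u _; split => // -[/andP[u0 _]].
  by rewrite /= /with_coordinate eqxx subr0 leNgt u0.
Qed.

Lemma nonpositive_path_negligible : L.-negligible (~` (positive_path (R := R))).
Proof.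
have n0 i : L.-negligible [set xi | (xi i <= 0)%R].
  apply/negligibleP; last exact: nonpositive_clock.
  by apply: measurable_set_le => //; exact: (@measurable_coordinate R i).
apply: (@negligibleS _ _ _ L ((\bigcup_k [set xi | (xi (inl (inl k)) <= 0)%R]) `|`
  (\bigcup_k [set xi | (xi (inl (inr k)) <= 0)%R]) `|`
  (\bigcup_k [set xi | (xi (inr k) <= 0)%R]))).
  move=> xi /existsNP[i /negP]; rewrite -leNgt.
  by case: i => [[k|k]|k] h; [left;left|left;right|right]; exists k.
by apply: negligibleU; first apply: negligibleU; apply: negligible_bigcup => k.
Qed.

Lemma measurable_nonpositive_path :
  measurable (~` (positive_path (R := R)) : set (path_space R)).
Proof. by apply: measurableC; exact: measurable_positive_path. Qed.

Lemma positive_path_ae : L (positive_path (R := R)) = 1.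
Proof.
rewrite -[RHS](@probability_setT _ _ _ L) -(setUv (positive_path (R := R))).
rewrite measureU0//; [exact: measurable_positive_path|exact: measurable_nonpositive_path|].
by apply/negligibleP; [exact: measurable_nonpositive_path|exact: nonpositive_path_negligible].
Qed.

(** Telescoping: among the first n components one is in place at time u, unless
    component n has already been installed by then. *)
Lemma state_sum n u : (0 <= u)%R ->
  \sum_(0 <= k < n) (L (perfect_at k u) + L (satisfactory_at k u)) + L (installed_by n u) = 1.
Proof.
move=> u0; elim: n => [|n ih].
  rewrite big_geq// add0e -positive_path_ae; congr (L _).
  by apply/seteqP; split => [xi []|xi g].
rewrite big_nat_recr//= -ih -!addeA; congr (_ + _).
by rewrite perfect_split satisfactory_split.
Qed.

(** The events counted by b have compensators with total density at most r on
    [0, t], so their probabilities are summable.  This is how explosion of the process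
    is excluded. *)
Lemma rate_vanishes (r t : R) (b : nat -> \bar R) (g : nat -> R -> \bar R) :
  (0 <= r)%R -> (forall n, measurable_fun setT (g n)) -> (forall n u, 0 <= g n u) ->
  (forall N u, (0 <= u)%R -> \sum_(0 <= n < N) g n u <= 1) ->
  (forall n, b n = r%:E * \int[leb]_(u in `[0%R, t]) g n u) -> b n @[n --> \oo] --> 0.
Proof.
move=> r0 mg g0 g1 bE.
have b0 n : 0 <= b n.
  by rewrite bE mule_ge0 ?lee_fin//; apply: integral_ge0.
have sumb N : \sum_(0 <= n < N) b n <= r%:E * leb `[0%R, t].
  rewrite (eq_bigr (fun n => r%:E * \int[leb]_(u in `[0%R, t]) g n u)); last first.
    by move=> n _.
  rewrite -ge0_sume_distrr//; last by move=> n _; exact: integral_ge0.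
  rewrite lee_wpmul2l ?lee_fin// -ge0_integral_sum//; last first.
    by move=> n; exact: (measurable_funTS (mg n)).
  rewrite -[leRHS]mul1e -integral_cst//; apply: ge0_le_integral => //.
  - by move=> u _; apply: sume_ge0.
  - by apply: emeasurable_sum => n; exact: (measurable_funTS (mg n)).
  - by move=> u /=; rewrite in_itv/= => /andP[u0 _]; exact: g1.
have fin : \sum_(0 <= n <oo) b n < +oo.
  apply: (@le_lt_trans _ _ (r%:E * leb `[0%R, t])).
    by apply: lime_le; [by apply: is_cvg_nneseries => n *; exact: b0|exact: nearW].
  rewrite lebesgue_measure_itv/=; case: ifP => _; last by rewrite mule0 ltry.
  by rewrite -EFinD -EFinM ltry.
have := nneseries_tail_cvg fin (fun k _ => b0 k).
apply: squeeze_cvge (@cvg_cst _ _ _ _ _) => //.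
apply: nearW => n; rewrite b0/=.
rewrite (nneseries_split n 1) ?addn1; last by move=> k _.
by rewrite big_nat1 leeDl// nneseries_ge0.
Qed.

Lemma nneseries_complement (a b : nat -> \bar R) (c : R) :
  (forall n, 0 <= a n) -> (forall n, 0 <= b n) ->
  (forall n, \sum_(0 <= k < n) a k + b n = c%:E) -> b n @[n --> \oo] --> 0 ->
  \sum_(0 <= k <oo) a k = c%:E.
Proof.
move=> a0 b0 abc bc; apply/cvg_lim => //.
have fb n : b n \is a fin_num.
  rewrite ge0_fin_numE//; apply: (@le_lt_trans _ _ c%:E); last exact: ltry.
  by rewrite -(abc n) leeDr// sume_ge0.
rewrite (_ : (fun n => _) = (fun n => c%:E - b n)); last first.
  by apply/funext => n; rewrite -(abc n) addeK.
rewrite -[X in _ --> X]sube0; apply: cvgeB => //; exact: cvg_cst.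
Qed.

Lemma installed_by_vanishes t : L (installed_by n t) @[n --> \oo] --> 0.
Proof.
(* Component n + 1 is installed after component n has degraded. *)
rewrite -(cvg_shiftS (fun n => L (installed_by n t))) /=.
have D0 : L (degraded_by n t) @[n --> \oo] --> 0.
  apply: (@rate_vanishes mu2 t _ (fun k u => L (perfect_at k u))).
  - exact: ltW.
  - by move=> n; exact: (measurable_section_measure (measurable_perfect_at n)).
  - by move=> n u; exact: measure_ge0.
  - move=> N u u0; rewrite -(state_sum N u0) big_split/= -addeA leeDl//.
    by rewrite adde_ge0// sume_ge0.
  - by move=> n; exact: degraded_rate.
apply: squeeze_cvge D0; last exact: cvg_cst.
apply: nearW => n; rewrite measure_ge0/= satisfactory_split.
by rewrite leeDr.
Qed.

Definition satisfactory_prob u := \sum_(0 <= k <oo) L (satisfactory_at k u).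

Lemma satisfactory_prob_ge0 u : 0 <= satisfactory_prob u.
Proof. exact: nneseries_ge0. Qed.

(** Some component is in place at time u almost surely, because infinitely many
    installations before u have probability zero. *)
Lemma state_total u : (0 <= u)%R ->
  \sum_(0 <= k <oo) L (perfect_at k u) + satisfactory_prob u = 1.
Proof.
move=> u0; rewrite -nneseriesD//.
apply: (@nneseries_complement _ (fun n => L (installed_by n u))) => //.
- by move=> n; rewrite adde_ge0.
- by move=> n; exact: state_sum.
- exact: installed_by_vanishes.
Qed.

Lemma satisfactory_prob_le1 u : (0 <= u)%R -> satisfactory_prob u <= 1.
Proof. by move=> /state_total <-; rewrite leeDr// nneseries_ge0. Qed.

Lemma measurable_satisfactory_prob : measurable_fun setT satisfactory_prob.
Proof.
apply: ge0_emeasurable_sum => // k _.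
exact: (measurable_section_measure (measurable_satisfactory_at k)).
Qed.

Lemma expected_degradations t :
  \sum_(0 <= k <oo) L (degraded_by k t) =
  mu2%:E * \int[leb]_(u in `[0%R, t]) (1 - satisfactory_prob u).
Proof.
under eq_eseriesr do rewrite degraded_rate.
rewrite nneseriesZl; last by move=> k _; exact: integral_ge0.
rewrite -integral_nneseries//; last first.
  move=> k; apply: measurable_funTS.
  exact: (measurable_section_measure (measurable_perfect_at k)).
congr (_ * _); apply: eq_integral => u; rewrite inE/= in_itv/= => /andP[u0 _].
rewrite -(state_total u0) addeK// ge0_fin_numE ?satisfactory_prob_ge0//.
by apply: le_lt_trans (satisfactory_prob_le1 u0) _; exact: ltry.
Qed.

Definition fails_by k t := [set xi : path_space R | positive_path xi /\
  installed xi k.+1 = failing xi k /\ (installed xi k.+1 <= t)%R].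

Lemma expected_failures t :
  \sum_(0 <= k <oo) L (fails_by k t) =
  mu1%:E * \int[leb]_(u in `[0%R, t]) satisfactory_prob u.
Proof.
under eq_eseriesr do rewrite failing_rate.
rewrite nneseriesZl; last by move=> k _; exact: integral_ge0.
rewrite -integral_nneseries//.
move=> k; apply: measurable_funTS.
exact: (measurable_section_measure (measurable_satisfactory_at k)).
Qed.

Lemma usos_partial (S : set (path_space R)) N u : measurable S -> S `<=` positive_path (R := R) ->
  \sum_(0 <= n < N) L (S `&` between_usos n u) + L (S `&` [set xi | (uso xi N < u)%R]) =
  L (S `&` [set xi | (uso xi 0 < u)%R]).
Proof.
move=> mS Sg.
have mV n : measurable [set xi : path_space R | (uso xi n < u)%R].
  by apply: measurable_set_lt => //; exact: measurable_uso.
elim: N => [|n ih]; first by rewrite big_geq// add0e.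
rewrite big_nat_recr//= -ih -addeA; congr (_ + _).
rewrite -measureU//=; last 3 first.
- by apply: measurableI => //; exact: measurable_between_usos_time.
- exact: measurableI.
- by apply/seteqP; split => // xi [[_ [_ /andP[_ un]]] [_ /=]]; rewrite ltNge un.
congr (L _); apply/seteqP; split => xi.
  move=> [[Sxi [g /andP[nu _]]]|[Sxi /= nu]]; split => //=.
  by apply: le_lt_trans nu; apply: le_uso => //; exact: Sg.
move=> [Sxi /= nu]; have [un|un] := leP u (uso xi n.+1); last by right.
by left; split => //; split; [exact: Sg|rewrite nu].
Qed.

(** Every time lies in exactly one gap between unscheduled opportunities, as these
    tend to infinity almost surely. *)
Lemma usos_exhaust k u :
  \sum_(0 <= n <oo) L (satisfactory_at k u `&` between_usos n u) =
  L (satisfactory_at k u).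
Proof.
have mS := measurable_satisfactory_at_time k u.
rewrite -[RHS]fineK ?fin_num_measure//.
apply: (@nneseries_complement _
  (fun n => L (satisfactory_at k u `&` [set xi | (uso xi n < u)%R]))) => //.
  move=> n; rewrite fineK ?fin_num_measure// usos_partial//; last by move=> xi [].
  congr (L _); apply/seteqP; split => [xi []//|xi S].
  split => //; case: S => g /andP[du _]; rewrite /= /uso big_ord0.
  apply: lt_le_trans du; apply: (le_lt_trans (installed_ge0 k g)).
  by rewrite ltrDl; exact: g.
rewrite -(cvg_shiftS (fun n => L (satisfactory_at k u `&` [set xi | (uso xi n < u)%R]))) /=.
have V0 : L [set xi | positive_path xi /\ (uso xi n.+1 <= u)%R] @[n --> \oo] --> 0.
  apply: (@rate_vanishes lambda u _ (fun n v => L (between_usos n v))).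
  - exact: ltW.
  - by move=> n; exact: (measurable_section_measure (measurable_between_usos n)).
  - by move=> n v; exact: measure_ge0.
  - move=> N v v0; rewrite (eq_bigr (fun n => L (positive_path (R := R) `&` between_usos n v))).
      rewrite (@le_trans _ _ (L (positive_path (R := R) `&` [set xi | (uso xi 0 < v)%R])))//.
        rewrite -(usos_partial N)//; [by rewrite leeDl|exact: measurable_positive_path].
      apply: probability_le1; apply: measurableI; first exact: measurable_positive_path.
      by apply: measurable_set_lt => //; exact: measurable_uso.
    by move=> n _; congr (L _); apply/seteqP; split => [xi [g b]|xi [_ b]].
  - by move=> n; exact: uso_rate.
apply: squeeze_cvge V0; last exact: cvg_cst.
apply: nearW => n; rewrite measure_ge0/=; apply: le_measure; rewrite ?inE.
- apply: measurableI => //.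
  by apply: measurable_set_lt => //; exact: measurable_uso.
- apply: measurableI; first exact: measurable_positive_path.
  by apply: measurable_set_le => //; exact: measurable_uso.
- by move=> xi [[g _] /ltW].
Qed.

Lemma trivIset_usos (F : nat -> set (path_space R)) (e : path_space R -> R) :
  (forall n, F n `<=` [set xi | positive_path xi /\ e xi = uso xi n.+1]) ->
  trivIset setT F.
Proof.
move=> FE m n _ _ [xi [/FE[g em] /FE[_ en]]].
have [mn|nm|//] := ltngtP m n.
  by have := lt_uso (n := n.+1) (m := m.+1) g mn; rewrite -em -en ltxx.
by have := lt_uso (n := m.+1) (m := n.+1) g nm; rewrite -em -en ltxx.
Qed.

(** Each opportunity is governed by its own gap; summing over the gaps restores the
    whole time axis, by [usos_exhaust]. *)
Lemma expected_opportunities t :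
  \sum_(0 <= k <oo) L (opportunity_by k t) =
  lambda%:E * \int[leb]_(u in `[0%R, t]) (if uso_window u then satisfactory_prob u else 0).
Proof.
pose F k n := opportunity_by k t `&` [set xi : path_space R | installed xi k.+1 = uso xi n.+1].
have mF k n : measurable (F k n).
  apply: measurableI; first exact: measurable_opportunity_by.
  by apply: measurable_set_eq; [exact: measurable_installed|exact: measurable_uso].
have use_meas : measurable [set u | uso_window u] by exact: measurable_uso_window.
have msat k := measurable_section_measure (measurable_satisfactory_at k).
have key k : L (opportunity_by k t) = lambda%:E * \int[leb]_(u in `[0%R, t])
    (if uso_window u then L (satisfactory_at k u) else 0).
  rewrite (_ : opportunity_by k t = \bigcup_n F k n); last first.
    apply/seteqP; split => [xi [g [a b c]]|xi [n _ []]//].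
    have [_ _ _ [cf|[[so|[[n en] _]] _]]] := removal_spec ttilde tau_gt0 k g.
    - by rewrite cf ltxx in a.
    - by case: b.
    - by exists n.
  have -> : L (\bigcup_n F k n) = \sum_(0 <= n <oo) L (F k n).
    rewrite measure_bigcup//; last first.
      by apply: (@trivIset_usos _ (fun xi => installed xi k.+1)) => n xi [[g _]].
    by apply: eq_eseriesl => n; rewrite in_setT.
  under eq_eseriesr do rewrite opportunity_rate.
  rewrite nneseriesZl; last by move=> n _; exact: integral_ge0.
  have mU n := measurable_section_measure (measurable_uso_window_at k n).
  rewrite -integral_nneseries//; last by move=> n; exact: (measurable_funTS (mU n)).
  congr (_ * _); apply: eq_integral => u _; case: ifPn => use.
    rewrite -usos_exhaust; apply: eq_eseriesr => n _; congr (L _).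
    by apply/seteqP; split => [xi [_ []]|xi []].
  rewrite eseries0// => n _ _; rewrite (_ : mkset _ = set0) ?measure0//.
  by apply/seteqP; split => // xi [].
under eq_eseriesr do rewrite key.
have mIf k : measurable_fun setT (fun u => if uso_window u then L (satisfactory_at k u) else 0).
  apply: measurable_fun_ifT => //; last exact: msat.
  exact: (measurable_fun_ltr (measurable_cst _) (measurable_remaining_time tau_gt0)).
rewrite nneseriesZl; last by move=> k _; apply: integral_ge0 => u _; case: ifP.
rewrite -integral_nneseries//; last 2 first.
- by move=> k; exact: (measurable_funTS (mIf k)).
- by move=> k u _; case: ifP.
congr (_ * _); apply: eq_integral => u _; case: ifPn => // _.
by rewrite eseries0.
Qed.

Definition scheduled_by k t := [set xi : path_space R | positive_path xi /\
  [/\ (installed xi k.+1 < failing xi k)%R,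
      epochs tau (gap xi) SO (installed xi k.+1) & (installed xi k.+1 <= t)%R]].

Definition expected_scheduled t := \sum_(0 <= k <oo) L (scheduled_by k t).

Lemma measurable_scheduled_by k t : measurable (scheduled_by k t).
Proof.
have mi := measurable_installed ttilde tau_gt0 k.+1.
apply: measurableI; first exact: measurable_positive_path.
rewrite (_ : (fun x => _) = [set xi : path_space R | (installed xi k.+1 < failing xi k)%R] `&`
  ([set xi : path_space R | epochs tau (gap xi) SO (installed xi k.+1)] `&`
   [set xi : path_space R | (installed xi k.+1 <= t)%R])); last first.
  by apply/seteqP; split => [xi [a b c]|xi [a [b c]]]; do ! split.
apply: measurableI.
  by apply: measurable_set_lt => //; exact: measurable_failing.
apply: measurableI; first exact: measurable_epochs.
exact: measurable_set_le.
Qed.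

Lemma measurable_fails_by k t : measurable (fails_by k t).
Proof.
have mi := measurable_installed ttilde tau_gt0 k.+1.
apply: measurableI; first exact: measurable_positive_path.
apply: measurableI; last exact: measurable_set_le.
by apply: measurable_set_eq => //; exact: measurable_failing.
Qed.

Lemma removal_causes k t :
  L (installed_by k.+1 t) =
  L (fails_by k t) + L (opportunity_by k t) + L (scheduled_by k t).
Proof.
rewrite -measureU//=; last 3 first.
- exact: measurable_fails_by.
- exact: measurable_opportunity_by.
- by apply/seteqP; split => // xi [[_ [e _]] [_ [+ _ _]]]; rewrite e ltxx.
rewrite -measureU//=; last 3 first.
- by apply: measurableU; [exact: measurable_fails_by|exact: measurable_opportunity_by].
- exact: measurable_scheduled_by.
- apply/seteqP; split => // xi [[[_ [e _]]|[_ [_ nso _]]] [_ [+ so _]]] //.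
  by rewrite e ltxx.
congr (L _); apply/seteqP; split => [xi [g it]|
  xi [[[g [_ it]]|[g [_ _ it]]]|[g [_ _ it]]]]; last 3 first.
- by split.
- by split.
- by split.
have [_ _ _ [cf|[_ lt]]] := removal_spec ttilde tau_gt0 k g; first by left; left.
have [so|nso] := pselect (epochs tau (gap xi) SO (installed xi k.+1)).
  by right; split.
by left; right; split.
Qed.

(** Entries into the satisfactory state minus exits from it are counted at time t by
    the probability of being there; exits are failures and replacements at
    opportunities of either type. *)
Lemma conservation t :
  mu2%:E * \int[leb]_(u in `[0%R, t]) (1 - satisfactory_prob u) =
  satisfactory_prob t + (mu1%:E * (\int[leb]_(u in `[0%R, t]) satisfactory_prob u) +
   lambda%:E * (\int[leb]_(u in `[0%R, t]) (if uso_window u then satisfactory_prob u else 0)) +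
   expected_scheduled t).
Proof.
rewrite -expected_degradations -expected_failures -expected_opportunities.
under eq_eseriesr do rewrite satisfactory_split removal_causes.
rewrite nneseriesD//; last by move=> k _ _; rewrite !adde_ge0.
by rewrite nneseriesD// ?nneseriesD// => k _ _; rewrite adde_ge0.
Qed.

(** A satisfactory component is replaced at the scheduled opportunity itself, so
    it is not observed there. *)
Lemma satisfactory_at_scheduled (j : nat) : satisfactory_prob (j%:R * tau)%R = 0.
Proof.
rewrite /satisfactory_prob eseries0// => k _ _.
rewrite (_ : satisfactory_at k _ = set0) ?measure0//; apply/seteqP; split => // xi.
move=> [g /andP[dj ji]]; case: j dj ji => [|j] dj ji.
  have : (0 < degraded xi k)%R.
    by apply: (le_lt_trans (installed_ge0 k g)); rewrite ltrDl; exact: g.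
  by rewrite mul0r in dj; rewrite ltNge dj.
have [_ f h _] := removal_spec ttilde tau_gt0 k g.
have uj : replacement_epoch tau ttilde xi (j.+1%:R * tau)%R by left; exists j.
by have := h _ uj dj (lt_le_trans ji f); rewrite leNgt ji.
Qed.

Lemma expected_scheduled_cycle (j : nat) t :
  (j%:R * tau <= t)%R -> (t < j.+1%:R * tau)%R ->
  expected_scheduled t = expected_scheduled (j%:R * tau)%R.
Proof.
move=> jt tj; apply: eq_eseriesr => k _; congr (L _); apply/seteqP.
split => xi [g [lt [m im] it]]; split => //; split => //; try by exists m.
  rewrite im ler_pM2r// ler_nat -ltnS -(ltr_nat R) -(ltr_pM2r tau_gt0) -im.
  exact: le_lt_trans tj.
exact: le_trans jt.
Qed.

Lemma le_expected_scheduled s t : (s <= t)%R ->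
  expected_scheduled s <= expected_scheduled t.
Proof.
move=> st; apply: lee_nneseries => [k _ _|k _]; first exact: measure_ge0.
apply: le_measure; rewrite ?inE; [exact: measurable_scheduled_by..|].
by move=> xi [g [a b c]]; split => //; split => //; exact: le_trans st.
Qed.

(** Costs are nonnegative, so expectation, sum over components and splitting by cause
    can be exchanged freely. *)
Lemma expected_cost cc cso cuso T : (0 <= cc)%R -> (0 <= cso)%R -> (0 <= cuso)%R ->
  \int[L]_xi total_cost tau pol (sojourn2 xi) (sojourn1 xi) (gap xi) cc cso cuso T =
  (cc * mu1)%:E * (\int[leb]_(u in `[0%R, T]) satisfactory_prob u) +
  (cuso * lambda)%:E *
    (\int[leb]_(u in `[0%R, T]) (if uso_window u then satisfactory_prob u else 0)) +
  cso%:E * expected_scheduled T.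
Proof.
move=> cc0 cso0 cuso0.
pose term k xi : \bar R := cc%:E * (\1_(fails_by k T) xi)%:E +
  cuso%:E * (\1_(opportunity_by k T) xi)%:E + cso%:E * (\1_(scheduled_by k T) xi)%:E.
have mM (c : R) (A : set (path_space R)) : measurable A ->
    measurable_fun setT (fun xi : path_space R => c%:E * (\1_A xi)%:E).
  by move=> mA; apply: measurable_funeM; apply/measurable_EFinP; exact: measurable_indic.
have mfail k := mM cc _ (measurable_fails_by k T).
have mopp k := mM cuso _ (measurable_opportunity_by k T).
have msch k := mM cso _ (measurable_scheduled_by k T).
have mterm k : measurable_fun setT (term k).
  by apply: emeasurable_funD => //; exact: emeasurable_funD.
have term0 k xi : 0 <= term k xi by rewrite !adde_ge0// mule_ge0// lee_fin.
transitivity (\int[L]_xi \sum_(0 <= k <oo) term k xi).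
  apply: ge0_ae_eq_integral => //.
  - exact: measurable_total_cost.
  - exact: ge0_emeasurable_sum.
  - move=> xi _; apply: nneseries_ge0 => k _ _; rewrite lee_fin; case: ifP => // _.
    by rewrite /cause_cost; case: removal_cause => // -[].
  - by move=> xi _; exact: nneseries_ge0.
  (* Off this null set the cause of each removal is determined by its time. *)
  exists (~` (positive_path (R := R))); split.
  - exact: measurable_nonpositive_path.
  - by apply/negligibleP; [exact: measurable_nonpositive_path|exact: nonpositive_path_negligible].
  move=> xi; apply: contra_not => g _; apply: eq_eseriesr => k _.
  rewrite removal_causeE// -/(installed xi k.+1) /term !indicE.
  have [_ f _ _] := removal_spec ttilde tau_gt0 k g.
  have -> : (xi \in fails_by k T) =
      (installed xi k.+1 == failing xi k) && (installed xi k.+1 <= T)%R.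
    by apply/idP/andP => [/set_mem[_ [/eqP e it]]|[/eqP e it]]; [split|exact: mem_set].
  have -> : (xi \in opportunity_by k T) = [&& (installed xi k.+1 < failing xi k)%R,
      ~~ `[< epochs tau (gap xi) SO (installed xi k.+1) >] & (installed xi k.+1 <= T)%R].
    by apply/idP/and3P => [/set_mem[_ [a /asboolPn b c]]|[a /asboolPn b c]];
      [split|exact: mem_set].
  have -> : (xi \in scheduled_by k T) = [&& (installed xi k.+1 < failing xi k)%R,
      `[< epochs tau (gap xi) SO (installed xi k.+1) >] & (installed xi k.+1 <= T)%R].
    by apply/idP/and3P => [/set_mem[_ [a /asboolP b c]]|[a /asboolP b c]];
      [split|exact: mem_set].
  rewrite lt_neqAle f andbT.
  case: (installed xi k.+1 <= T)%R; rewrite ?andbF ?andbT; last by rewrite !mule0 !adde0.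
  case: eqVneq => _ /=; first by rewrite !mule0 !adde0 mule1.
  by case: asboolP => _ /=; rewrite !mule0 ?adde0 ?add0e mule1.
rewrite integral_nneseries//.
have intterm k : \int[L]_xi term k xi = cc%:E * L (fails_by k T) +
    cuso%:E * L (opportunity_by k T) + cso%:E * L (scheduled_by k T).
  have scaled (c : R) A : (0 <= c)%R -> measurable A ->
      \int[L]_xi (c%:E * (\1_A xi)%:E) = c%:E * L A.
    move=> c0 mA; rewrite ge0_integralZl//; first by rewrite integral_indic// setIT.
    exact/measurable_EFinP.
  have pos (c : R) (A : set (path_space R)) xi : (0 <= c)%R -> 0 <= c%:E * (\1_A xi)%:E.
    by move=> c0; rewrite mule_ge0// lee_fin.
  rewrite /term ge0_integralD//; last 3 first.
  - by move=> xi _; rewrite adde_ge0// pos.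
  - exact: emeasurable_funD.
  - by move=> xi _; rewrite pos.
  rewrite ge0_integralD//; last 2 first.
  - by move=> xi _; rewrite pos.
  - by move=> xi _; rewrite pos.
  rewrite !scaled//; [exact: measurable_scheduled_by|exact: measurable_opportunity_by|
    exact: measurable_fails_by].
under eq_eseriesr do rewrite intterm.
rewrite nneseriesD; last 2 first.
- by move=> k _ _; rewrite adde_ge0// mule_ge0.
- by move=> k _ _; rewrite mule_ge0.
rewrite nneseriesD; last 2 first.
- by move=> k _ _; rewrite mule_ge0.
- by move=> k _ _; rewrite mule_ge0.
by rewrite !nneseriesZl// expected_failures expected_opportunities !muleA -!EFinM.
Qed.

End Rates.

(** * A linear integral equation *)

Section LinearIntegralEquation.
Context {R : realType}.
Local Notation leb := (@lebesgue_measure R).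

(** With r s := c - m / beta + m (s - a) - beta int_a^s q, the equation reads
    q s = r s + m / beta, whence r' = - beta r and exp (beta (s - a)) r s is
    constant.  The value at b follows by continuity, which is why the equation is not
    required there. *)
Lemma linear_integral_equation (q : R -> R) (a b c m beta : R) :
  a < b -> beta != 0 -> leb.-integrable `[a, b] (EFin \o q) ->
  (forall s, a <= s < b -> q s = c + m * (s - a) - beta * \int[leb]_(u in `[a, s]) q u) ->
  \int[leb]_(u in `[a, b]) q u =
  m / beta * (b - a) + (c - m / beta) * ((1 - expR (- beta * (b - a))) / beta).
Proof.
move=> ab beta0 intq qE.
pose Q x := \int[leb]_(u in `[a, x]) q u.
have cQ : {within `[a, b], continuous Q}.
  exact: (parameterized_integral_continuous (ltW ab) intq).
pose r x := c - m / beta + m * (x - a) - beta * Q x.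
pose G x := expR (beta * (x - a)) * r x.
have cE : continuous (fun x : R => expR (beta * (x - a))).
  move=> x; apply: continuous_comp; last exact: continuous_expR.
  by apply: cvgM; [exact: cvg_cst|apply: cvgB; [exact: cvg_id|exact: cvg_cst]].
have cL : continuous (fun x : R => c - m / beta + m * (x - a)).
  move=> x; apply: cvgD; first exact: cvg_cst.
  by apply: cvgM; [exact: cvg_cst|apply: cvgB; [exact: cvg_id|exact: cvg_cst]].
have cG : {within `[a, b], continuous G}.
  have wE := @continuous_subspaceT _ _ `[a, b] _ cE.
  have wL := @continuous_subspaceT _ _ `[a, b] _ cL.
  move=> x; apply: cvgM; first exact: wE.
  by apply: cvgB; [exact: wL|apply: cvgM; [exact: cvg_cst|exact: cQ]].
have dG x : x \in `]a, b[%R -> is_derive x 1 G 0.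
  rewrite in_itv/= => /andP[ax xb].
  have cQx : {for x, continuous Q}.
    have xab : x \in `]a, b[ by rewrite in_itv/= ax.
    by have := (continuous_within_itvP _ ab).1 cQ => -[/(_ x xab)].
  have cqx : {for x, continuous q}.
    have qnear : \forall y \near x, c + m * (y - a) - beta * Q y = q y.
      near=> y; rewrite qE//; apply/andP; split.
        by apply: ltW; near: y; exact: lt_nbhsr.
      by near: y; exact: lt_nbhsl.
    rewrite /prop_for /continuous_at qE ?(ltW ax)//.
    apply: cvg_trans (near_eq_cvg qnear) _.
    apply: cvgB; last by apply: cvgM; [exact: cvg_cst|exact: cQx].
    apply: cvgD; first exact: cvg_cst.
    by apply: cvgM; [exact: cvg_cst|apply: cvgB; [exact: cvg_id|exact: cvg_cst]].
  have [dQ dQE] := continuous_FTC1_closed xb intq ax cqx.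
  have isQ : is_derive x 1 Q (q x).
    by apply: (DeriveDef dQ); rewrite -derive1E; exact: dQE.
  have isL : is_derive x 1 r (m - beta * q x).
    rewrite /r; apply: is_derive_eq; rewrite /GRing.scale/=; ring.
  have isE : is_derive x 1 (fun y : R => expR (beta * (y - a))) (beta * expR (beta * (x - a))).
    apply: is_derive_eq; rewrite /GRing.scale/=; ring.
  apply: is_derive_eq; rewrite /GRing.scale/= qE ?(ltW ax)// -/(Q x) /r; by field.
(* The derivative of G vanishes, so the mean value theorem gives G b = G a. *)
have [y _] := MVT ab dG cG.
rewrite mul0r => /eqP; rewrite subr_eq0 => /eqP.
rewrite /G /r subrr mulr0 expR0 mulr0 mul1r addr0.
rewrite {2}/Q set_itv1 Rintegral_set1 mulr0 subr0 -/(Q b) => GE.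
have e0 := expR_gt0 (beta * (b - a)).
have : c - m / beta + m * (b - a) - beta * Q b =
    expR (- beta * (b - a)) * (c - m / beta).
  by rewrite -[X in _ = _ * X]GE mulrA -expRD mulNr addNr expR0 mul1r.
move=> h.
have -> : Q b = (c - m / beta + m * (b - a) -
    expR (- beta * (b - a)) * (c - m / beta)) / beta.
  by rewrite -h; field.
by field.
Unshelve. all: by end_near.
Qed.

End LinearIntegralEquation.

(** * One scheduled cycle *)

Section Cycle.
Context {R : realType}.
Local Notation leb := (@lebesgue_measure R).

Lemma Rintegral_itv_split (f : R -> R) (a c b : R) : a <= c -> c <= b ->
  leb.-integrable `[a, b] (EFin \o f) ->
  \int[leb]_(u in `[a, b]) f u =
  \int[leb]_(u in `[a, c]) f u + \int[leb]_(u in `[c, b]) f u.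
Proof.
move=> ac cb intf; apply/eqP; rewrite addrC -subr_eq; apply/eqP.
rewrite (Rintegral_itvB intf) ?bnd_simp//; apply: Rintegral_itv_obnd_cbnd.
apply: integrableS intf => //; apply: subset_itv; rewrite bnd_simp//.
Qed.

(** Endpoints carry no mass; needed because the policy switches at one endpoint and
    scheduled opportunities sit at the other. *)
Lemma eq_Rintegral_itvoo (f g : R -> R) (a b : R) :
  leb.-integrable `[a, b] (EFin \o f) -> leb.-integrable `[a, b] (EFin \o g) ->
  (forall u, a < u < b -> f u = g u) ->
  \int[leb]_(u in `[a, b]) f u = \int[leb]_(u in `[a, b]) g u.
Proof.
move=> intf intg fg.
have oo (h : R -> R) : leb.-integrable `[a, b] (EFin \o h) ->
    \int[leb]_(u in `[a, b]) h u = \int[leb]_(u in `]a, b[) h u.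
  move=> inth; rewrite -Rintegral_itv_obnd_cbnd; last first.
    apply: integrableS inth => //; exact: subset_itv_oc_cc.
  rewrite Rintegral_itv_bndo_bndc//.
  apply: integrableS inth => //; exact: subset_itv_oo_cc.
rewrite !oo//; apply: eq_Rintegral => u; rewrite inE/= in_itv/=; exact: fg.
Qed.

(** Before s + sigma the satisfactory state is also emptied by unscheduled opportunities,
    so the balance has coefficient A; afterwards it has coefficient b.  The increment of
    N is then forced by the balance and by q (s + tau) = 0. *)
Lemma cycle_integrals (q N : R -> R) (use : R -> bool) (mu1 mu2 lambda s sigma tau : R) :
  0 < mu1 -> 0 < mu2 -> 0 < lambda -> 0 <= s -> 0 < sigma -> sigma < tau ->
  let J t := \int[leb]_(u in `[0, t]) (if use u then q u else 0) in
  let I t := \int[leb]_(u in `[0, t]) q u in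
  let A := lambda + mu1 + mu2 in let b := mu1 + mu2 in
  let d := mu2 / A - mu2 / b - mu2 / A * expR (- A * sigma) in
  let K1 := mu2 / A * (sigma - (1 - expR (- A * sigma)) / A) in
  (forall t, leb.-integrable `[0, t] (EFin \o q)) ->
  (forall t, leb.-integrable `[0, t] (fun u => (if use u then q u else 0)%:E)) ->
  (forall u, s <= u -> u < s + tau -> use u = (u < s + sigma)) ->
  q s = 0 -> q (s + tau) = 0 ->
  (forall t, s <= t -> t < s + tau -> N t = N s) ->
  (forall t, 0 <= t -> mu2 * (t - I t) = q t + (mu1 * I t + lambda * J t + N t)) ->
  [/\ I (s + tau) = I s + (K1 + ((tau - sigma) * (mu2 / b) +
        d * b^-1 * (1 - expR (- b * (tau - sigma))))),
      J (s + tau) = J s + K1 &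
      N (s + tau) = N s + (mu2 / b + d * expR (- b * (tau - sigma)))].
Proof.
move=> mu1_gt0 mu2_gt0 lambda_gt0 s0 sigma0 sigma_tau J I A b d K1 intq intu useE qs qst NE cons.
have A0 : A != 0 by rewrite gt_eqF// !addr_gt0.
have b0 : b != 0 by rewrite gt_eqF// !addr_gt0.
have sub (f : R -> \bar R) a c : 0 <= a -> leb.-integrable `[0, c] f -> leb.-integrable `[a, c] f.
  move=> a0; apply: integrableS => //.
  by apply: subset_itv; rewrite bnd_simp.
have Isplit a c : 0 <= a -> a <= c -> I c = I a + \int[leb]_(u in `[a, c]) q u.
  by move=> a0 ac; apply: Rintegral_itv_split.
have Jsplit a c : 0 <= a -> a <= c ->
    J c = J a + \int[leb]_(u in `[a, c]) (if use u then q u else 0).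
  by move=> a0 ac; apply: Rintegral_itv_split.
have ssig : 0 <= s + sigma by rewrite addr_ge0// ltW.
have ss : s <= s + sigma by rewrite lerDl ltW.
have J1 t : s <= t -> t <= s + sigma -> J t = J s + \int[leb]_(u in `[s, t]) q u.
  move=> st ts; rewrite (Jsplit s t)//; congr (_ + _).
  apply: eq_Rintegral_itvoo; [exact: sub|exact: sub|].
  move=> u /andP[su ut]; rewrite useE ?ltW//.
    by rewrite (lt_le_trans ut ts).
  by rewrite (lt_le_trans ut)// (le_trans ts)// lerD2l ltW.
have J2 t : s + sigma <= t -> t <= s + tau -> J t = J (s + sigma).
  move=> st ts; rewrite (Jsplit (s + sigma) t)//.
  rewrite (@eq_Rintegral_itvoo _ (fun=> 0)); first by rewrite Rintegral_cst// mul0r addr0.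
  - exact: sub.
  - exact: integrable0.
  - move=> u /andP[su ut]; rewrite useE; last exact: lt_le_trans ut ts.
      by rewrite ltNge (ltW su).
    by apply: le_trans (ltW su); rewrite lerDl ltW.
have cs := cons s s0; rewrite qs add0r in cs.
have phase1 : \int[leb]_(u in `[s, s + sigma]) q u = K1.
  rewrite (@linear_integral_equation _ q s (s + sigma) 0 mu2 A)//.
  - by rewrite addrAC subrr add0r /K1; field.
  - by rewrite ltrDl.
  - exact: sub.
  - move=> t /andP[st ts].
    have tt : t < s + tau by rewrite (lt_trans ts)// ltrD2l.
    have := cons t (le_trans s0 st).
    rewrite NE// (J1 t st (ltW ts)) (Isplit s t)// /A => ct; lra.
have qsig : q (s + sigma) = mu2 * sigma - A * K1.
  have := cons (s + sigma) ssig.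
  rewrite NE ?ltrD2l// (J1 _ ss (lexx _)) (Isplit _ _ s0 ss) phase1.
  by rewrite /A => ct; lra.
have phase2 : \int[leb]_(u in `[s + sigma, s + tau]) q u =
    (tau - sigma) * (mu2 / b) + d * b^-1 * (1 - expR (- b * (tau - sigma))).
  rewrite (@linear_integral_equation _ q (s + sigma) (s + tau) (mu2 * sigma - A * K1) mu2 b)//.
  - rewrite (_ : s + tau - (s + sigma) = tau - sigma); last by ring.
    by rewrite /d /K1; field; rewrite A0 b0.
  - by rewrite ltrD2l.
  - exact: sub.
  - move=> t /andP[st ts].
    have st' : s <= t by rewrite (le_trans _ st)// lerDl ltW.
    have := cons t (le_trans s0 st').
    rewrite NE// (J2 t st (ltW ts)) (J1 _ ss (lexx _)) phase1.
    rewrite (Isplit (s + sigma) t)// (Isplit _ _ s0 ss) phase1.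
    by rewrite /A /b => ct; lra.
have stau : s + sigma <= s + tau by rewrite lerD2l ltW.
have IE : I (s + tau) = I s + (K1 + ((tau - sigma) * (mu2 / b) +
        d * b^-1 * (1 - expR (- b * (tau - sigma))))).
  rewrite (Isplit (s + sigma) (s + tau))// (Isplit _ _ s0 ss).
  by rewrite phase1 phase2 -[LHS]addrA.
have JE : J (s + tau) = J s + K1 by rewrite J2// (J1 _ ss (lexx _)) phase1.
split => //.
have tau0 : 0 < tau by exact: lt_trans sigma_tau.
have := cons (s + tau) (addr_ge0 s0 (ltW tau0)); rewrite qst add0r IE JE.
set K2 := _ + d * b^-1 * _ => ct.
have -> : N (s + tau) = mu2 * (s + tau - (I s + (K1 + K2))) - mu1 * (I s + (K1 + K2)) -
    lambda * (J s + K1) by lra.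
have -> : N s = mu2 * (s - I s) - mu1 * I s - lambda * J s by lra.
rewrite /K2 /d /K1 /A /b in A0 b0 *; by field; rewrite A0 b0.
Qed.

(** Squeezing: e T lies between j C and (j + 1) C where j is the integer part
    of T / tau. *)
Lemma monotone_average (e : R -> R) (tau C : R) : 0 < tau ->
  (forall s t, 0 <= s -> s <= t -> e s <= e t) ->
  (forall j : nat, e (j%:R * tau) = j%:R * C) ->
  T^-1 * e T @[T --> +oo] --> C / tau.
Proof.
move=> tau0 emono eC.
have C0 : 0 <= C.
  have := emono _ _ (lexx 0) (ltW tau0).
  by have := eC 0; rewrite !mul0r => ->; have := eC 1; rewrite !mul1r => ->.
have bnd T : 0 < T -> C / tau - C / T <= T^-1 * e T <= C / tau + C / T.
  move=> T0.
  (* Number of cycles completed by time T. *)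
  pose j := `|Num.floor (T / tau)|%N.
  have fl0 : 0 <= Num.floor (T / tau) by rewrite floor_ge0 divr_ge0 ?ltW.
  have jE : (j%:R : R) = (Num.floor (T / tau))%:~R.
    by rewrite /j -[in RHS](gez0_abs fl0).
  have jT : j%:R * tau <= T by rewrite -ler_pdivlMr// jE floor_le.
  have Tj : T < j.+1%:R * tau.
    by rewrite -ltr_pdivrMr// -natr1 jE -[X in _ + X]/(1%:~R) -intrD floorD1_gt.
  have e1 : j%:R * C <= e T by rewrite -eC; apply: emono => //; apply: mulr_ge0 => //; exact: ltW.
  have e2 : e T <= j.+1%:R * C by rewrite -eC; apply: emono; exact: ltW.
  have jle : j%:R * C <= T / tau * C by rewrite ler_wpM2r// ler_pdivlMr.
  have jge : T / tau * C <= j.+1%:R * C by rewrite ler_wpM2r// ltW// ltr_pdivrMr.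
  rewrite -natr1 in e2 jge.
  have E : T * (C / tau - C / T) = T / tau * C - C by field; rewrite !gt_eqF.
  have F : T * (C / tau + C / T) = T / tau * C + C by field; rewrite !gt_eqF.
  by apply/andP; split; rewrite -(ler_pM2l T0) ?E ?F mulVKf ?gt_eqF//; lra.
have inv0 : C / T @[T --> +oo] --> 0.
  rewrite -[0](mulr0 C); apply: cvgM; first exact: cvg_cst.
  apply: (iffRL (gtr0_cvgV0 _)); last exact: cvg_id.
  by near=> T; near: T; exact: nbhs_pinfty_gt.
apply: (@squeeze_cvgr _ _ _ _ (fun T => C / tau - C / T) (fun T => C / tau + C / T)).
- near=> T; apply: bnd; near: T; exact: nbhs_pinfty_gt.
- rewrite -[X in _ --> X]subr0; apply: cvgB => //; exact: cvg_cst.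
- rewrite -[X in _ --> X]addr0; apply: cvgD => //; exact: cvg_cst.
Unshelve. all: by end_near.
Qed.

End Cycle.

(** * The long-run average *)

Section LongRun.
Context {R : realType} (tau ttilde mu1 mu2 lambda : R).
Hypotheses (tau_gt0 : 0 < tau) (mu1_gt0 : 0 < mu1) (mu2_gt0 : 0 < mu2)
  (lambda_gt0 : 0 < lambda) (ttilde_gt0 : 0 < ttilde) (ttilde_lt_tau : ttilde < tau).
Variable L : probability (path_space R) R.
Hypothesis indep : independent_exponentials L (clock_rate mu1 mu2 lambda).
Local Notation leb := (@lebesgue_measure R).
Local Notation psat := (satisfactory_prob tau ttilde L).
Local Notation uso_window := (uso_window tau ttilde).
Local Notation sched := (expected_scheduled tau ttilde L).

Let q u := fine (psat u).
Let I T := \int[leb]_(u in `[0, T]) q u.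
Let J T := \int[leb]_(u in `[0, T]) (if uso_window u then q u else 0).
Let N T := fine (sched T).

Lemma uso_window_cycle (j : nat) u : j%:R * tau <= u -> u < j%:R * tau + tau ->
  uso_window u = (u < j%:R * tau + (tau - ttilde)).
Proof.
move=> ju uj; rewrite /uso_window /remaining_time.
have -> : Num.floor (u / tau) = j%:Z.
  apply: floor_def; rewrite intrD -!pmulrn ler_pdivlMr// ju ltr_pdivrMr//.
  by rewrite mulrDl mul1r.
rewrite intrD -pmulrn mulrDl mul1r ltrBrDl addrA.
by rewrite -ltrBrDr.
Qed.

Let q_fin u : 0 <= u -> psat u = (q u)%:E.
Proof.
move=> u0; rewrite /q fineK// ge0_fin_numE ?satisfactory_prob_ge0//.
apply: le_lt_trans (ltry 1).
exact: (satisfactory_prob_le1 ttilde tau_gt0 mu1_gt0 mu2_gt0 lambda_gt0 indep u0).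
Qed.

Let q_bnd u : 0 <= u -> 0 <= q u <= 1.
Proof.
move=> u0; rewrite -!lee_fin -q_fin// satisfactory_prob_ge0.
exact: (satisfactory_prob_le1 ttilde tau_gt0 mu1_gt0 mu2_gt0 lambda_gt0 indep u0).
Qed.

Let mq : measurable_fun setT q.
Proof.
apply: measurableT_comp; first exact: fine_measurable.
exact: measurable_satisfactory_prob.
Qed.

Let integrable01 (f : R -> R) T : measurable_fun setT f ->
  (forall u, 0 <= u -> 0 <= f u <= 1) -> leb.-integrable `[0, T] (EFin \o f).
Proof.
move=> mf f01; apply: measurable_bounded_integrable => //.
- by rewrite /= lebesgue_measure_itv/=; case: ifP => // _; rewrite -EFinD ltry.
- exact: measurable_funTS.
- exists 1; split => // M M1 u /=; rewrite in_itv/= => /andP[u0 _].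
  have /andP[f0 f1] := f01 u u0.
  by rewrite ger0_norm// (le_trans f1)// ltW.
Qed.

Let intq T : leb.-integrable `[0, T] (EFin \o q).
Proof. exact: integrable01. Qed.

Let intu T : leb.-integrable `[0, T] (fun u => (if uso_window u then q u else 0)%:E).
Proof.
apply: (@integrable01 (fun u => if uso_window u then q u else 0)).
  apply: measurable_fun_ifT => //.
  exact: (measurable_fun_ltr (measurable_cst _) (measurable_remaining_time tau_gt0)).
by move=> u u0; case: ifP => // _; [exact: q_bnd|rewrite lexx ler01].
Qed.

Let IE T : (\int[leb]_(u in `[0%R, T]) psat u)%E = (I T)%:E.
Proof.
rewrite /I /Rintegral fineK; last exact: (integrable_fin_num _ (intq T)).
by apply: eq_integral => u; rewrite inE/= in_itv/= => /andP[u0 _]; exact: q_fin.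
Qed.

Let JE T : (\int[leb]_(u in `[0%R, T]) (if uso_window u then psat u else 0%R))%E = (J T)%:E.
Proof.
rewrite /J /Rintegral fineK; last exact: (integrable_fin_num _ (intu T)).
apply: eq_integral => u; rewrite inE/= in_itv/= => /andP[u0 _].
by case: ifP => // _; exact: q_fin.
Qed.

Let perfect_integral T : 0 <= T ->
  (\int[leb]_(u in `[0%R, T]) (1 - psat u))%E = (T - I T)%:E.
Proof.
move=> T0; have -> : T - I T = \int[leb]_(u in `[0, T]) (1 - q u).
  rewrite RintegralB//; last first.
    by apply: (@integrable01 (fun=> 1)) => // u _; rewrite lexx ler01.
  rewrite Rintegral_cst// mul1r; congr (_ - _).
  by rewrite /= lebesgue_measure_itv/= lte_fin; case: ltgtP T0 => // _ _; rewrite /= subr0.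
rewrite /Rintegral fineK; last first.
  apply: integrable_fin_num => //; apply: (@integrable01 (fun u => 1 - q u)).
    by apply: measurable_funB => //; exact: measurable_cst.
  by move=> u /q_bnd/andP[u0 u1]; rewrite subr_ge0 u1 gerBl.
apply: eq_integral => u; rewrite inE/= in_itv/= => /andP[u0 _].
by rewrite q_fin// EFinB.
Qed.

Let sched_fin T : 0 <= T -> sched T = (N T)%:E.
Proof.
move=> T0; rewrite /N fineK// ge0_fin_numE; last exact: nneseries_ge0.
have := conservation ttilde tau_gt0 mu1_gt0 mu2_gt0 lambda_gt0 indep T.
rewrite perfect_integral// IE JE q_fin// -!EFinM => h.
rewrite ltNge leye_eq; apply/negP => /eqP sy; rewrite sy in h.
by [].
Qed.

Let balance T : 0 <= T ->
  mu2 * (T - I T) = q T + (mu1 * I T + lambda * J T + N T).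
Proof.
move=> T0.
have := conservation ttilde tau_gt0 mu1_gt0 mu2_gt0 lambda_gt0 indep T.
by rewrite perfect_integral// IE JE q_fin// sched_fin// -!EFinM -!EFinD => -[].
Qed.

Let q_scheduled (j : nat) : q (j%:R * tau) = 0.
Proof. by rewrite /q satisfactory_at_scheduled. Qed.

Let A := lambda + mu1 + mu2.
Let b := mu1 + mu2.
Let sigma := tau - ttilde.
Let d := mu2 / A - mu2 / b - mu2 / A * expR (- A * sigma).
Let K1 := mu2 / A * (sigma - (1 - expR (- A * sigma)) / A).
Let K2 := ttilde * (mu2 / b) + d * b^-1 * (1 - expR (- b * ttilde)).
Let K0 := mu2 / b + d * expR (- b * ttilde).

Let cycles (j : nat) : [/\ I (j%:R * tau) = j%:R * (K1 + K2),
  J (j%:R * tau) = j%:R * K1 & N (j%:R * tau) = j%:R * K0].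
Proof.
elim: j => [|j [ihI ihJ ihN]].
  have I0 : I 0 = 0 by rewrite /I set_itv1 Rintegral_set1.
  have J0 : J 0 = 0 by rewrite /J set_itv1 Rintegral_set1.
  rewrite !mul0r I0 J0; split => //.
  have := balance (lexx 0); rewrite I0 J0 subrr !mulr0 !add0r.
  by have := q_scheduled 0; rewrite mul0r => -> /esym; rewrite add0r.
have sE : j.+1%:R * tau = j%:R * tau + tau by rewrite -natr1 mulrDl mul1r.
have s0 : 0 <= j%:R * tau by apply: mulr_ge0 => //; exact: ltW.
have sig0 : 0 < sigma by rewrite subr_gt0.
have sigt : sigma < tau by rewrite gtrBl.
have tE : tau - sigma = ttilde by rewrite /sigma subKr.
have [] := @cycle_integrals R q N uso_window mu1 mu2 lambda (j%:R * tau) sigma tau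
  mu1_gt0 mu2_gt0 lambda_gt0 s0 sig0 sigt intq intu.
- by move=> u; exact: uso_window_cycle.
- exact: q_scheduled.
- by rewrite -sE; exact: q_scheduled.
- by move=> t st; rewrite -sE => ts; rewrite /N (expected_scheduled_cycle _ _ _ st ts).
- exact: balance.
rewrite -sE tE -/(I _) -/(J _) -/(I _) -/(J _) ihI ihJ ihN => -> -> ->.
have E (x : R) : j.+1%:R * x = j%:R * x + x by rewrite -natr1 mulrDl mul1r.
by rewrite !E; split.
Qed.

Lemma average_cost cc cso cuso : 0 <= cc -> 0 <= cso -> 0 <= cuso ->
  ((T^-1)%:E * \int[L]_xi total_cost tau (threshold_policy ttilde)
     (sojourn2 xi) (sojourn1 xi) (gap xi) cc cso cuso T)%E @[T --> +oo] -->
  ((cc * mu1 * (K1 + K2) + cuso * lambda * K1 + cso * K0) / tau)%:E.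
Proof.
move=> cc0 cso0 cuso0.
(* Expected cost up to T as a real number; all the expectations are finite. *)
pose e T := cc * mu1 * I T + cuso * lambda * J T + cso * N T.
have eE T : 0 <= T -> (\int[L]_xi total_cost tau (threshold_policy ttilde)
     (sojourn2 xi) (sojourn1 xi) (gap xi) cc cso cuso T)%E = (e T)%:E.
  move=> T0; rewrite (expected_cost ttilde tau_gt0 mu1_gt0 mu2_gt0 lambda_gt0 indep)//.
  by rewrite IE JE sched_fin// -!EFinM -!EFinD.
have emono s t : 0 <= s -> s <= t -> e s <= e t.
  move=> s0 st; have t0 := le_trans s0 st.
  rewrite /e; apply: lerD; first apply: lerD.
  - apply: ler_wpM2l; first by rewrite mulr_ge0// ltW.
    rewrite /I (Rintegral_itv_split s0 st)// lerDl; apply: Rintegral_ge0 => u /=.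
    by rewrite in_itv/= => /andP[su _]; have /andP[] := q_bnd (le_trans s0 su).
  - apply: ler_wpM2l; first by rewrite mulr_ge0// ltW.
    rewrite /J (Rintegral_itv_split s0 st)// lerDl; apply: Rintegral_ge0 => u /=.
    rewrite in_itv/= => /andP[su _]; case: ifP => // _.
    by have /andP[] := q_bnd (le_trans s0 su).
  - apply: ler_wpM2l => //; rewrite -lee_fin -!sched_fin//.
    exact: le_expected_scheduled.
have eC (j : nat) : e (j%:R * tau) = j%:R * (cc * mu1 * (K1 + K2) + cuso * lambda * K1 + cso * K0).
  by have [iI iJ iN] := cycles j; rewrite /e iI iJ iN; ring.
have lim := monotone_average tau_gt0 emono eC.
apply: cvg_EFin.
  by near=> T; rewrite eE.
apply: cvg_trans lim; apply: near_eq_cvg; near=> T; rewrite /= eE//.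
Unshelve. all: by end_near.
Qed.

End LongRun.

(** * Transfer to the given probability space *)

Section Law.
Context {R : realType} {d : measure_display} {Omega : measurableType d}
  (P : probability Omega R).
Variables (mu1 mu2 lambda : R) (X2 X1 W : nat -> {RV P >-> R}).

Definition random_path (omega : Omega) : path_space R :=
  fun i => joint_family X2 X1 W i omega.

Lemma measurable_random_path : measurable_fun setT random_path.
Proof. by apply: measurable_to_path_space => i; exact: measurable_funPT. Qed.

HB.instance Definition _ := isMeasurableFun.Build _ _ _ _ random_path
  measurable_random_path.

Lemma law_independent_exponentials : replacement_model mu1 mu2 lambda X2 X1 W ->
  independent_exponentials (distribution P random_path) (clock_rate mu1 mu2 lambda).
Proof.
move=> [h2 h1 hw ind] K A uK mA.
rewrite /distribution /pushforward.
rewrite [X in P X = _](_ : _ = \big[setI/setT]_(i <- K) (joint_family X2 X1 W i @^-1` A i)).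
  rewrite ind//; apply: eq_bigr => i _.
  by case: i => [[k|k]|k]; [apply: h2|apply: h1|apply: hw].
by rewrite -bigcap_seq; apply/seteqP; split => omega.
Qed.

End Law.

Theorem theorem3 (R : realType) (d : measure_display) (Omega : measurableType d)
  (P : probability Omega R)
  (mu1 mu2 lambda tau cso cuso cc ttilde : R)
  (X2 X1 W : nat -> {RV P >-> R})
  (mu1_gt0 : 0 < mu1) (mu2_gt0 : 0 < mu2) (lambda_gt0 : 0 < lambda)
  (tau_gt0 : 0 < tau)
  (cso_gt0 : 0 < cso) (cso_le_cuso : cso <= cuso) (cuso_lt_cc : cuso < cc)
  (ttilde_gt0 : 0 < ttilde) (ttilde_lt_tau : ttilde < tau)
  (model : replacement_model mu1 mu2 lambda X2 X1 W) :
  has_long_run_average_cost tau cc cso cuso (threshold_policy ttilde) X2 X1 W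
    (tau^-1 *
     (cc * mu1 *
        (ttilde * (mu2 / (mu1 + mu2)) +
         (mu2 / (lambda + mu1 + mu2) - mu2 / (mu1 + mu2)
          - mu2 / (lambda + mu1 + mu2) *
            expR ((lambda + mu1 + mu2) * (ttilde - tau))) *
         (mu1 + mu2)^-1 * (1 - expR (- (mu1 + mu2) * ttilde)))
      + (cuso * lambda + cc * mu1) * (mu2 / (lambda + mu1 + mu2)) *
        (tau - ttilde - (lambda + mu1 + mu2)^-1 *
           (1 - expR ((lambda + mu1 + mu2) * (ttilde - tau))))
      + cso *
        (mu2 / (mu1 + mu2) +
         (mu2 / (lambda + mu1 + mu2) - mu2 / (mu1 + mu2)
          - mu2 / (lambda + mu1 + mu2) *
            expR ((lambda + mu1 + mu2) * (ttilde - tau))) *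
         expR (- (mu1 + mu2) * ttilde)))).
Proof.
have cuso_ge0 : 0 <= cuso by rewrite (le_trans (ltW cso_gt0)).
have cc_ge0 : 0 <= cc by rewrite (le_trans cuso_ge0)// ltW.
have indep := law_independent_exponentials model.
have := average_cost tau_gt0 mu1_gt0 mu2_gt0 lambda_gt0 ttilde_gt0 ttilde_lt_tau
  indep cc_ge0 (ltW cso_gt0) cuso_ge0.
rewrite /has_long_run_average_cost.
have expE T : expected_total_cost tau cc cso cuso (threshold_policy ttilde) X2 X1 W T =
    (\int[distribution P (random_path X2 X1 W)]_xi
       total_cost tau (threshold_policy ttilde) (sojourn2 xi) (sojourn1 xi) (gap xi)
         cc cso cuso T)%E.
  rewrite ge0_integral_distribution//.
    by apply: measurable_total_cost => //; exact: ltW.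
  move=> xi; apply: nneseries_ge0 => k _ _; rewrite lee_fin; case: ifP => // _.
  by rewrite /cause_cost; case: removal_cause => [|[]]//; exact: ltW.
under eq_fun do rewrite -expE.
congr (_ --> _); congr EFin.
have -> : (lambda + mu1 + mu2) * (ttilde - tau) = - (lambda + mu1 + mu2) * (tau - ttilde).
  by ring.
field; apply/and3P; split; apply: lt0r_neq0 => //; rewrite ?addr_gt0//.
Qed.
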